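(* For all integers $d\ge1$ and $k\ge2$, \[ m(d,k)\ge L_{\mathrm{pp}}(d,k)=\max_{1\le s\le\min(d,\lfloor\log_2k\rfloor)}\left(k-2^s+\left(\left\lfloor\frac ds\right\rfloor+1\right)^{s-(d\bmod s)}\left(\left\lfloor\frac ds\right\rfloor+2\right)^{d\bmod s}\right), \] where $s$ ranges over integers.
   Context: A $k$-component Gaussian mixture density on $\mathbb{R}^d$ is a function $\Phi(x)=\sum_{i=1}^k\alpha_i\phi_i(x)$, where $\alpha_i>0$, $\sum_{i=1}^k\alpha_i=1$, and $\phi_i(x)=(2\pi)^{-d/2}\det(\Sigma_i)^{-1/2}\exp\left(-\frac12(x-\mu_i)^\top\Sigma_i^{-1}(x-\mu_i)\right)$ with $\mu_i\in\mathbb{R}^d$ and each $\Sigma_i$ a (symmetric) positive definite $d\times d$ matrix. $\mathrm{Mode}(\Phi)$ is the set of all (not necessarily strict) local maximum points of $\Phi$: $x\in\mathrm{Mode}(\Phi)$ iff there is $\rho>0$ with $\Phi(y)\le\Phi(x)$ whenever $\|y-x\|<\rho$. $m(d,k)$ denotes the supremum of $|\mathrm{Mode}(\Phi)|$ over all $k$-component Gaussian mixture densities $\Phi$ on $\mathbb{R}^d$ for which $\mathrm{Mode}(\Phi)$ is finite. For integers $a\ge0$, $b\ge1$, $a\bmod b$ is the remainder: $a=b\lfloor a/b\rfloor+(a\bmod b)$ with $0\le a\bmod b<b$. *)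

(* Defs.v *)
From mathcomp Require Import all_boot all_order all_algebra finmap.
From mathcomp Require Import all_classical all_reals all_analysis.

Set Implicit Arguments.
Unset Strict Implicit.
Unset Printing Implicit Defensive.

Import Order.TTheory GRing.Theory Num.Theory.

Local Open Scope classical_set_scope.
Local Open Scope ring_scope.

Definition quad_form (R : realType) (d : nat) (A : 'M[R]_d) (x : 'cV[R]_d) : R :=
  (x^T *m A *m x) 0 0.

(* The norm that the library puts on ['cV[R]_d] is the sup norm. *)
Definition euclidean_norm (R : realType) (d : nat) (x : 'cV[R]_d) : R :=
  Num.sqrt (\sum_(i < d) x i 0 ^+ 2).

Definition posdef (R : realType) (d : nat) (A : 'M[R]_d) : Prop :=
  A^T = A /\ forall x : 'cV[R]_d, x != 0 -> 0 < quad_form A x.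

Definition gaussian_density (R : realType) (d : nat)
    (mu : 'cV[R]_d) (Sigma : 'M[R]_d) (x : 'cV[R]_d) : R :=
  (2 * pi) `^ (- (d%:R / 2)) * (\det Sigma) `^ (- 2^-1) *
  expR (- 2^-1 * quad_form (invmx Sigma) (x - mu)).

Definition gaussian_mixture (R : realType) (d k : nat)
    (Phi : 'cV[R]_d -> R) : Prop :=
  exists (alpha : 'I_k -> R) (mu : 'I_k -> 'cV[R]_d) (Sigma : 'I_k -> 'M[R]_d),
    [/\ forall i, 0 < alpha i,
        \sum_(i < k) alpha i = 1,
        forall i, posdef (Sigma i) &
        forall x, Phi x =
          \sum_(i < k) alpha i * gaussian_density (mu i) (Sigma i) x].

Definition Mode (R : realType) (d : nat) (Phi : 'cV[R]_d -> R) : set 'cV[R]_d :=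
  [set x | exists2 rho : R, 0 < rho &
    forall y, euclidean_norm (y - x) < rho -> Phi y <= Phi x].

(* Extended-real valued, since the supremum is not assumed to be finite. *)
Definition max_modes (R : realType) (d k : nat) : \bar R :=
  ereal_sup [set (#|` fset_set (Mode Phi)|%fset%:R)%:E |
    Phi in [set Phi : 'cV[R]_d -> R |
      gaussian_mixture k Phi /\ finite_set (Mode Phi)]].

(* [trunc_log 2 k] is the floor of the base-2 logarithm of [k] for [0 < k]; the
   two subtractions never truncate, as [2 ^ s <= k] and [d %% s < s]. *)
Definition Lpp (d k : nat) : nat :=
  (\max_(1 <= s < (minn d (trunc_log 2 k)).+1)
      (k - 2 ^ s +
       (d %/ s + 1) ^ (s - d %% s) * (d %/ s + 2) ^ (d %% s)))%N.

(* Main.v *)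
Require Import Defs.
From mathcomp Require Import all_boot all_order all_algebra.
From mathcomp Require Import all_classical all_reals all_analysis.
From mathcomp Require Import finmap ring lra.

(** The idea. Three constructions produce mixtures with many modes.

- In dimension [d] two components can have [d + 1] modes ([attains_2]). The
critical points of exp (- L |x| ^ 2) + exp (kap - L sum_j (x_j - 1) ^ 2 / r_j) all
lie on a ridge line, whose parameter [t] is the ratio of the two terms. On it the
critical equation reads [L * stairs t + kap = ln t], where [stairs], as a function
of [ln t], climbs one step near each [ln r_j]. With widely separated [r_j] a
staircase of [d] steps meets the diagonal in [d + 1] points where it is the
flatter of the two graphs, and there, by the Cauchy-Schwarz inequality, the
Hessian is negative definite.

- The product of two mixtures in independent groups of coordinates is a mixture,
and its modes are the pairs of modes ([attains_mul]).

- A very narrow extra component adds one mode ([attains_S]).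

Taking the product of [s] two-component mixtures on blocks of dimension [d / s] or
[d / s + 1], and then adding [k - 2 ^ s] narrow components, gives the bound.

The delicate point is that the final mixture must have finitely many modes. The
constructions therefore carry along the condition that every critical point with
nonpositive Hessian has a negative definite Hessian ([nondegenerate]). Such points
are isolated ([critical_decay]), and since all critical points of a mixture lie in
a cube ([critical_confined]), compactness makes them finite in number. The
condition is inherited by products. For two components it says that the staircase
is nowhere tangent to the diagonal, which holds for all but finitely many [kap],
because tangency points solve a polynomial equation. For a narrow component placed
at a noncritical point [p] it is an open condition away from [p], where the new
component is small together with two derivatives ([nondegenerate_far]), while near
[p] a critical point with nonpositive Hessian has to sit so close to the centre of
the new component that the latter dominates the Hessian ([nondegenerate_near]).

All covariance matrices are diagonal, so that everything reduces to finite sums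
over coordinates and to one-variable calculus along lines. *)

Set Implicit Arguments.
Unset Strict Implicit.
Unset Printing Implicit Defensive.

Import Order.TTheory GRing.Theory Num.Theory.
Import numFieldNormedType.Exports.

Local Open Scope classical_set_scope.
Local Open Scope ring_scope.

(** * Calculus on a line *)

Lemma MVT_line (R : realType) (phi dphi : R -> R) (a b : R) : a < b ->
  (forall t : R, is_derive t 1 phi (dphi t)) ->
  exists2 c, a < c < b & phi b - phi a = dphi c * (b - a).
Proof.
move=> ab dphiP.
have [c cab e] : exists2 c, c \in `]a, b[%R & phi b - phi a = dphi c * (b - a).
  apply: MVT => // x; apply: continuous_in_subspaceT => y _.
  by apply: differentiable_continuous; apply/derivable1_diffP; case: (dphiP y).
by exists c => //; rewrite in_itv in cab.
Qed.

Lemma derive_gt0_near (R : realType) (f : R -> R) (x a : R) :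
  is_derive x 1 f a -> f x = 0 -> 0 < a ->
  exists2 e, 0 < e & forall h, 0 < h < e -> 0 < f (x + h).
Proof.
move=> [fx fxa] fx0 a0.
have cv : (fun h => h^-1 *: (f (h *: (1 : R) + x) - f x)) @ 0^' --> a.
  by rewrite -fxa; exact: fx.
have /= : \forall h \near 0^', 0 < h^-1 *: (f (h *: (1 : R) + x) - f x).
  by apply: (cvgr_gt _ cv).
move=> [e /= e0 eP]; exists e => // h /andP[h0 he].
have := eP h; rewrite /= sub0r normrN gtr0_norm// he gt_eqF// => /(_ isT isT).
rewrite fx0 subr0 scaler1 addrC; rewrite /GRing.scale /=.
by rewrite pmulr_rgt0// invr_gt0.
Qed.

(** The second-order necessary condition: a positive second derivative at a
critical point would make [phi] increase to the right of it. *)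
Lemma line_max (R : realType) (phi dphi : R -> R) (a : R) :
  (forall t : R, is_derive t 1 phi (dphi t)) -> is_derive (0 : R) 1 dphi a ->
  (exists2 e, 0 < e & forall t, `|t| < e -> phi t <= phi 0) ->
  dphi 0 = 0 /\ a <= 0.
Proof.
move=> d1 d2 [e e0 max0].
have dphi0 : dphi 0 = 0.
  have [_ <-] := d1 0.
  have H : is_derive (0 : R) 1 phi 0.
    apply: (@derive1_at_max _ _ (- e) e).
    - by rewrite ge0_cp ?ltW.
    - by move=> t _; case: (d1 t).
    - by rewrite in_itv /= e0 oppr_lt0 e0.
    - by move=> t; rewrite in_itv /= -ltr_norml; exact: max0.
  by case: H.
split => //; rewrite leNgt; apply/negP => a0.
have [e' e'0 pos] := derive_gt0_near d2 dphi0 a0.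
pose h := Num.min e e' / 2.
have m0 : 0 < Num.min e e' by rewrite lt_min e0 e'0.
have h0 : 0 < h by rewrite divr_gt0.
have hm : h < Num.min e e' by rewrite /h; lra.
move: hm; rewrite lt_min => /andP[he he'].
have [c /andP[c0 ch] E] := MVT_line h0 d1.
have := pos c; rewrite add0r c0 (lt_trans ch he') => /(_ isT) posc.
have := max0 h; rewrite gtr0_norm// => /(_ he).
by rewrite -subr_le0 E subr0 leNgt mulr_gt0.
Qed.

(** Integrating [ddphi <= - m] once bounds the slope, twice the decrease. *)
Lemma line_decay (R : realType) (phi dphi ddphi : R -> R) (m : R) :
  (forall t : R, is_derive t 1 phi (dphi t)) ->
  (forall t : R, is_derive t 1 dphi (ddphi t)) ->
  (forall t, 0 <= t <= 1 -> ddphi t <= - m) -> dphi 0 = 0 ->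
  phi 1 <= phi 0 - m / 2 /\ dphi 1 <= - m.
Proof.
move=> d1 d2 le_m dphi0.
have slope t : 0 < t <= 1 -> dphi t <= - m * t.
  move=> /andP[t0 t1]; have [c /andP[c0 ct] E] := MVT_line t0 d2.
  move: E; rewrite dphi0 !subr0 => ->.
  by rewrite ler_pM2r// le_m// ltW//= (le_trans (ltW ct)).
split; last by have := slope 1; rewrite ltr01 lexx mulr1; exact.
pose psi t := phi t + m / 2 * t ^+ 2.
have d3 (t : R) : is_derive t 1 psi (dphi t + m * t).
  have := d1 t => ?; rewrite /psi.
  apply: is_derive_eq; rewrite /GRing.scale /= !mulr1; lra.
have [c /andP[c0 c1] E] := MVT_line ltr01 d3.
have := slope c; rewrite c0 ltW// => /(_ isT) => s.
move: E; rewrite /psi; lra.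
Qed.

(** * Vectors, quadratic forms and compact boxes *)

Definition sqnorm (R : realType) (d : nat) (x : 'cV[R]_d) : R :=
  \sum_j x j 0 ^+ 2.

Definition pairing (R : realType) (d : nat) (g : 'I_d -> R) (u : 'cV[R]_d) : R :=
  \sum_j g j * u j 0.

Definition qform (R : realType) (d : nat) (h : 'I_d -> 'I_d -> R)
    (u : 'cV[R]_d) : R :=
  \sum_i \sum_j h i j * (u i 0 * u j 0).

Definition box (R : realType) (d : nat) (x : 'cV[R]_d) (r : R) : set 'cV[R]_d :=
  [set y | forall j, `|y j 0 - x j 0| <= r].

Lemma sqnorm_ge0 (R : realType) d (x : 'cV[R]_d) : 0 <= sqnorm x.
Proof. by apply: sumr_ge0 => j _; exact: sqr_ge0. Qed.

Lemma sqr_coord_le (R : realType) d (x : 'cV[R]_d) j : x j 0 ^+ 2 <= sqnorm x.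
Proof.
by rewrite /sqnorm (bigD1 j)//= lerDl sumr_ge0// => i _; exact: sqr_ge0.
Qed.

Lemma sqnorm_gt0 (R : realType) d (x : 'cV[R]_d) : x != 0 -> 0 < sqnorm x.
Proof.
move=> x0; rewrite lt_neqAle sqnorm_ge0 andbT eq_sym.
apply: contra x0 => /eqP s0; apply/eqP/colP => j; rewrite mxE.
have := sqr_coord_le x j; rewrite s0 => le0.
by apply/eqP; rewrite -sqrf_eq0 eq_le le0 sqr_ge0.
Qed.

Lemma coordM_le (R : realType) d (u : 'cV[R]_d) i j :
  `|u i 0 * u j 0| <= sqnorm u.
Proof.
rewrite normrM.
have := sqr_coord_le u i; have := sqr_coord_le u j.
rewrite -(real_normK (num_real (u i 0))) -(real_normK (num_real (u j 0))).
move: `|_| `|_| => a b ha hb; have := sqr_ge0 (a - b); nra.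
Qed.

Lemma qform_bound (R : realType) d (h : 'I_d -> 'I_d -> R) u :
  `|qform h u| <= (\sum_i \sum_j `|h i j|) * sqnorm u.
Proof.
rewrite mulr_suml (le_trans (ler_norm_sum _ _ _))// ler_sum// => i _.
rewrite mulr_suml (le_trans (ler_norm_sum _ _ _))// ler_sum// => j _.
by rewrite normrM ler_wpM2l// coordM_le.
Qed.

Lemma qformD (R : realType) d (h k : 'I_d -> 'I_d -> R) u :
  qform (fun i j => h i j + k i j) u = qform h u + qform k u.
Proof.
rewrite /qform -big_split; apply: eq_bigr => i _.
by rewrite -big_split; apply: eq_bigr => j _; rewrite mulrDl.
Qed.

(** Cauchy-Schwarz with positive weights, from the nonnegativity of
[\sum_j m_j * (S * u_j - T * x_j / m_j) ^ 2] where
[S] is the sum of the [x_j ^ 2 / m_j] and [T] that of the [x_j * u_j]. *)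
Lemma cauchy_schwarz_weighted (R : realType) (J : finType) (m x u : J -> R) :
  (forall j, 0 < m j) ->
  (\sum_j x j * u j) ^+ 2 <=
  (\sum_j x j ^+ 2 / m j) * (\sum_j m j * u j ^+ 2).
Proof.
move=> m0; set S := \sum_j x j ^+ 2 / m j; set T := \sum_j x j * u j.
set U := \sum_j m j * u j ^+ 2.
have S0 : 0 <= S.
  by apply: sumr_ge0 => j _; rewrite mulr_ge0 ?sqr_ge0// invr_ge0 ltW.
have E : \sum_j m j * (S * u j - T * (x j / m j)) ^+ 2 = S * (S * U - T ^+ 2).
  transitivity (\sum_j S ^+ 2 * (m j * u j ^+ 2) -
      \sum_j 2 * S * T * (x j * u j) + \sum_j T ^+ 2 * (x j ^+ 2 / m j)).
    rewrite -sumrB -big_split; apply: eq_bigr => j _ /=.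
    by field; rewrite gt_eqF.
  by rewrite -!mulr_sumr -/S -/T -/U; ring.
have : 0 <= S * (S * U - T ^+ 2).
  by rewrite -E sumr_ge0// => j _; rewrite mulr_ge0 ?sqr_ge0// ltW.
move: S0; rewrite le_eqVlt => /predU1P[S0 _|S0]; last first.
  by rewrite pmulr_rge0// subr_ge0.
suff -> : T = 0 by rewrite -S0 mul0r expr0n.
rewrite /T big1// => j _.
have : x j ^+ 2 / m j = 0.
  apply/eqP; move/esym/eqP: S0; rewrite psumr_eq0; last first.
    by move=> i _; rewrite mulr_ge0 ?sqr_ge0// invr_ge0 ltW.
  by move=> /allP/(_ j); rewrite mem_index_enum; exact.
move/eqP; rewrite mulf_eq0 invr_eq0 (gt_eqF (m0 j)) orbF sqrf_eq0 => /eqP ->.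
by rewrite mul0r.
Qed.

Lemma nbhs_colP (R : realType) d (x : 'cV[R]_d) (P : set 'cV[R]_d) :
  nbhs x P <->
  exists2 e : R, 0 < e & forall y : 'cV[R]_d, (forall j, `|y j 0 - x j 0| < e) -> P y.
Proof.
split.
  move=> /nbhs_ballP[e /= e0 eP]; exists e => // y ye; apply: eP; split => // i j.
  by rewrite (ord1 j) /ball /= distrC ye.
move=> [e e0 eP]; apply/nbhs_ballP; exists e => // y [_ ye]; apply: eP => j.
by have := ye j 0; rewrite /ball /= distrC.
Qed.

Lemma box_compact (R : realType) d (x : 'cV[R]_d) r : compact (box x r).
Proof.
pose A (i : 'I_d) : set R := `[x i 0 - r, x i 0 + r]%classic.
have cA : compact [set v : 'rV[R]_d | forall i, A i (v ord0 i)].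
  by apply: rV_compact => i; exact: segment_compact.
have -> : box x r = trmx @` [set v : 'rV[R]_d | forall i, A i (v ord0 i)].
  rewrite predeqE => y; split => [yx|[v vA <-]].
    exists y^T; last by rewrite trmxK.
    by move=> i; rewrite /A /= in_itv /= mxE -ler_distl yx.
  by move=> j; have := vA j; rewrite /A /= in_itv /= mxE -ler_distl.
apply: continuous_compact cA; apply: continuous_subspaceT => v.
move=> B /nbhs_colP[e e0 eB]; apply/nbhs_ballP; exists e => // w [_ vw].
by apply: eB => j; rewrite !mxE distrC; have := vw 0 j.
Qed.

(** An infinite [S] would accumulate at some point of [K]. *)
Lemma compact_isolated_finite (T : ptopologicalType) (K S : set T) :
  compact K -> S `<=` K ->
  (forall x, K x -> \forall y \near x, S y -> y = x) -> finite_set S.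
Proof.
move=> cK SK iso; apply: contrapT => /infiniteP/pcard_leP[f].
have [x [Kx clx]] : K `&` cluster (f @ \oo) !=set0.
  apply: cK; exists 0%N => // n _ /=; apply: SK.
  exact: (@funS _ _ setT S f n I).
have all : (f @ \oo) (f @` setT) by exists 0%N => // n _; exists n.
have [_ [[N1 _ <-] N1x]] := clx _ _ all (iso x Kx).
have e1 : f N1 = x by apply: N1x; exact: (@funS _ _ setT S f N1 I).
have tail : (f @ \oo) (f @` [set n | (N1 < n)%N]).
  by exists N1.+1 => // n /= Nn; exists n.
have [y [[n Nn <-] yx]] := clx _ _ tail (iso x Kx).
have : f n = f N1 by rewrite e1; apply: yx; exact: (@funS _ _ setT S f n I).
move=> /(@inj _ _ setT f n N1 (mem_set I) (mem_set I)) E.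
by rewrite /= E ltnn in Nn.
Qed.

Section Continuity.
Context {R : realType} {T : topologicalType}.
Implicit Types f g : T -> R.

Lemma continuous_add f g :
  continuous f -> continuous g -> continuous (fun x => f x + g x).
Proof. by move=> cf cg x; apply: cvgD; [exact: cf|exact: cg]. Qed.

Lemma continuous_sub f g :
  continuous f -> continuous g -> continuous (fun x => f x - g x).
Proof. by move=> cf cg x; apply: cvgB; [exact: cf|exact: cg]. Qed.

Lemma continuous_mul f g :
  continuous f -> continuous g -> continuous (fun x => f x * g x).
Proof. by move=> cf cg x; apply: cvgM; [exact: cf|exact: cg]. Qed.

Lemma continuous_cst (c : R) : continuous (fun _ : T => c).
Proof. by move=> x; exact: cvg_cst. Qed.

Lemma continuous_abs f : continuous f -> continuous (fun x => `|f x|).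
Proof. by move=> cf x; apply: cvg_norm; exact: cf. Qed.

Lemma continuous_exp f : continuous f -> continuous (fun x => expR (f x)).
Proof.
by move=> cf x; apply: continuous_comp; [exact: cf|exact: continuous_expR].
Qed.

Lemma continuous_sumf (I : finType) (F : I -> T -> R) :
  (forall i, continuous (F i)) -> continuous (fun t => \sum_i F i t).
Proof.
move=> cF.
have -> : (fun t => \sum_i F i t) = \sum_i F i.
  by apply/funext => s; rewrite fct_sumE.
apply: (big_ind (fun f : T -> R => continuous f)) => //.
  exact: continuous_cst.
by move=> f g ? ?; exact: continuous_add.
Qed.

Lemma continuous_near_lt f x a :
  continuous f -> f x < a -> \forall y \near x, f y < a.
Proof. by move=> cf fxa; exact: (cvgr_lt _ (cf x)). Qed.

Lemma continuous_near_gt f x a :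
  continuous f -> a < f x -> \forall y \near x, a < f y.
Proof. by move=> cf fxa; exact: (cvgr_gt _ (cf x)). Qed.

End Continuity.

(** * Twice differentiable functions and nondegenerate critical points *)

(** Derivatives are only ever taken along lines, so [g] and [h] are the gradient
and the Hessian matrix of [f] in the sense that they compute them. *)
Record smooth2 (R : realType) (d : nat) (f : 'cV[R]_d -> R)
    (g : 'cV[R]_d -> 'I_d -> R) (h : 'cV[R]_d -> 'I_d -> 'I_d -> R) : Prop := {
  smooth2_cont : continuous f;
  smooth2_grad_cont : forall j, continuous (fun x => g x j);
  smooth2_hess_cont : forall i j, continuous (fun x => h x i j);
  smooth2_grad : forall (x u : 'cV[R]_d) (t : R),
    is_derive t 1 (fun t => f (x + t *: u)) (pairing (g (x + t *: u)) u);
  smooth2_hess : forall (x u : 'cV[R]_d) (i : 'I_d) (t : R),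
    is_derive t 1 (fun t => g (x + t *: u) i)
      (\sum_j h (x + t *: u) i j * u j 0) }.

Arguments smooth2_grad_cont {R d f g h} _ j.
Arguments smooth2_hess_cont {R d f g h} _ i j.
Arguments smooth2_grad {R d f g h} _ x u t.
Arguments smooth2_hess {R d f g h} _ x u i t.

Definition critical (R : realType) d (g : 'cV[R]_d -> 'I_d -> R) x :=
  forall j, g x j = 0.

Definition hess_le0 (R : realType) d (h : 'cV[R]_d -> 'I_d -> 'I_d -> R) x :=
  forall u, qform (h x) u <= 0.

(** The uniform gap makes negative definiteness an open condition without any
appeal to the compactness of the unit sphere. *)
Definition hess_lt0 (R : realType) d (h : 'cV[R]_d -> 'I_d -> 'I_d -> R) x :=
  exists2 lam, 0 < lam & forall u, qform (h x) u <= - lam * sqnorm u.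

(** Only points that can be local maxima are constrained: saddle points may be
degenerate. *)
Definition nondegenerate (R : realType) d g (h : 'cV[R]_d -> 'I_d -> 'I_d -> R) :=
  forall x, critical g x -> hess_le0 h x -> hess_lt0 h x.

Definition local_max (R : realType) d (f : 'cV[R]_d -> R) x :=
  \forall y \near x, f y <= f x.

Lemma is_derive_sumf (R : realType) (I : finType) (F : I -> R -> R)
    (dF : I -> R) (t : R) :
  (forall i, is_derive t 1 (F i) (dF i)) ->
  is_derive t 1 (fun t => \sum_i F i t) (\sum_i dF i).
Proof.
move=> dFP.
have -> : (fun t => \sum_i F i t) = \sum_i F i.
  by apply/funext => s; rewrite fct_sumE.
apply: (big_ind2 (fun f df => is_derive t 1 f df)) => //.
  exact: is_derive_cst.
by move=> f1 df1 f2 df2 ? ?; exact: is_deriveD.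
Qed.

Section Smooth2.
Context {R : realType} {d : nat} {f : 'cV[R]_d -> R}.
Context {g : 'cV[R]_d -> 'I_d -> R} {h : 'cV[R]_d -> 'I_d -> 'I_d -> R}.
Hypothesis sf : smooth2 f g h.

Lemma smooth2_line2 (x u : 'cV[R]_d) (t : R) :
  is_derive t 1 (fun t => pairing (g (x + t *: u)) u) (qform (h (x + t *: u)) u).
Proof.
apply: is_derive_sumf => i; have := smooth2_hess sf x u i t => dgi.
have -> : \sum_j h (x + t *: u) i j * (u i 0 * u j 0) =
    u i 0 *: (\sum_j h (x + t *: u) i j * u j 0).
  by rewrite /GRing.scale /= mulr_sumr; apply: eq_bigr => j _; ring.
have -> : (fun t => g (x + t *: u) i * u i 0) =
    u i 0 *: (fun t => g (x + t *: u) i).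
  by apply/funext => s; rewrite /GRing.scale /= /GRing.scale /= mulrC.
exact: is_deriveZ.
Qed.

Lemma local_max_critical x : local_max f x -> critical g x /\ hess_le0 h x.
Proof.
move=> /nbhs_colP[e e0 emax].
have along u : pairing (g x) u = 0 /\ qform (h x) u <= 0.
  have C0 : 0 < 1 + \sum_j `|u j 0| by rewrite ltr_pwDl// sumr_ge0.
  have := @line_max R (fun t => f (x + t *: u))
    (fun t => pairing (g (x + t *: u)) u) (qform (h (x + 0 *: u)) u)
    (smooth2_grad sf x u) (smooth2_line2 x u 0).
  rewrite scale0r addr0; apply.
  exists (e / (1 + \sum_j `|u j 0|)); first exact: divr_gt0.
  move=> t te; apply: emax => j; rewrite !mxE addrAC subrr add0r normrM.
  move: te; rewrite ltr_pdivlMr//; apply: le_lt_trans; rewrite ler_wpM2l//.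
  by rewrite (bigD1 j)//= addrCA lerDl addr_ge0// sumr_ge0.
split=> [j|u]; last by case: (along u).
have [] := along (delta_mx j 0); rewrite /pairing (bigD1 j)//= big1 => [|i ij].
  by rewrite mxE !eqxx mulr1 addr0.
by rewrite mxE (negbTE ij) mulr0.
Qed.

Lemma hess_lt0_near x lam : (forall u, qform (h x) u <= - lam * sqnorm u) ->
  0 < lam ->
  \forall y \near x, forall u, qform (h y) u <= - (lam / 2) * sqnorm u.
Proof.
move=> hx lam0.
pose w y := \sum_i \sum_j `|h y i j - h x i j|.
have wx : w x < lam / 2.
  rewrite /w big1 ?divr_gt0// => i _.
  by rewrite big1// => j _; rewrite subrr normr0.
have wc : continuous w.
  apply: continuous_sumf => i; apply: continuous_sumf => j.
  apply: continuous_abs; apply: continuous_sub; last exact: continuous_cst.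
  exact: (smooth2_hess_cont sf).
apply: filterS (continuous_near_lt wc wx) => y wy u.
have -> : h y = fun i j => h x i j + (h y i j - h x i j).
  by apply/funext => i; apply/funext => j; rewrite addrC subrK.
rewrite qformD.
have := hx u; have := le_trans (ler_norm _) (qform_bound (fun i j => h y i j - h x i j) u).
rewrite -/(w y); have := sqnorm_ge0 u.
move: (qform _ _) (qform _ _) (sqnorm u) => q1 q2 s; nra.
Qed.

(** The function is strictly concave along every segment issuing from [x] in a
small cube, hence falls off quadratically and has no other critical point. *)
Lemma critical_decay x : critical g x -> hess_lt0 h x ->
  exists2 lam, 0 < lam & \forall y \near x,
    f y <= f x - lam * sqnorm (y - x) /\ (critical g y -> y = x).
Proof.
move=> cx [lam lam0 hx]; exists (lam / 2 / 2); first by rewrite !divr_gt0.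
have /nbhs_colP[e e0 eP] := hess_lt0_near hx lam0.
apply/nbhs_colP; exists e => // y ye; set u := y - x.
have near_seg t : 0 <= t <= 1 ->
    qform (h (x + t *: u)) u <= - (lam / 2 * sqnorm u).
  move=> /andP[t0 t1]; rewrite -mulNr; apply: eP => j.
  rewrite !mxE addrAC subrr add0r normrM ger0_norm//.
  by rewrite (le_lt_trans _ (ye j))// ler_piMl.
have [] := line_decay (smooth2_grad sf x u) (smooth2_line2 x u) near_seg.
  by rewrite scale0r addr0 /pairing big1// => j _; rewrite cx mul0r.
rewrite scale0r addr0 scale1r /u addrC subrK => dec slope; split.
  by move: dec; rewrite mulrAC.
move=> cy; apply/eqP; rewrite -subr_eq0; apply/negPn/negP => /sqnorm_gt0 s0.
move: slope; rewrite /pairing big1 => [|j _]; last by rewrite cy mul0r.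
by rewrite oppr_ge0 leNgt !mulr_gt0// invr_gt0.
Qed.

End Smooth2.

(** Lets an estimate on an explicit gradient be used for any other one. *)
Lemma smooth2_grad_unique (R : realType) d (f : 'cV[R]_d -> R) g h g' h' x u :
  smooth2 f g h -> smooth2 f g' h' -> pairing (g x) u = pairing (g' x) u.
Proof.
move=> sf sf'; have := smooth2_grad sf x u 0; have := smooth2_grad sf' x u 0.
by rewrite !scale0r !addr0 => -[_ <-] [_ <-].
Qed.

(** * Axis-parallel Gaussian mixtures *)

(** Weights are not normalised: scaling a function does not move its modes. *)
Definition gauss (R : realType) (d : nat) (a mu : 'I_d -> R) (x : 'cV[R]_d) : R :=
  expR (- (\sum_j a j * (x j 0 - mu j) ^+ 2) / 2).

Definition gauss_grad (R : realType) d (a mu : 'I_d -> R) (x : 'cV[R]_d) j : R :=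
  - (a j * (x j 0 - mu j)) * gauss a mu x.

Definition gauss_hess (R : realType) d (a mu : 'I_d -> R) (x : 'cV[R]_d) i j : R :=
  (a i * (x i 0 - mu i) * (a j * (x j 0 - mu j)) - a i *+ (i == j)) * gauss a mu x.

Definition mixture (R : realType) d (I : finType) (c : I -> R)
    (a mu : I -> 'I_d -> R) (x : 'cV[R]_d) : R :=
  \sum_i c i * gauss (a i) (mu i) x.

Definition mixture_grad (R : realType) d (I : finType) (c : I -> R)
    (a mu : I -> 'I_d -> R) (x : 'cV[R]_d) j : R :=
  \sum_i c i * gauss_grad (a i) (mu i) x j.

Definition mixture_hess (R : realType) d (I : finType) (c : I -> R)
    (a mu : I -> 'I_d -> R) (x : 'cV[R]_d) k l : R :=
  \sum_i c i * gauss_hess (a i) (mu i) x k l.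

Lemma gauss_gt0 (R : realType) d (a mu : 'I_d -> R) x : 0 < gauss a mu x.
Proof. exact: expR_gt0. Qed.

Lemma continuous_coord (R : realType) d (j : 'I_d) (m : R) :
  continuous (fun x : 'cV[R]_d => x j 0 - m).
Proof.
by apply: continuous_sub; [exact: coord_continuous|exact: continuous_cst].
Qed.

Lemma continuous_gauss (R : realType) d (a mu : 'I_d -> R) :
  continuous (gauss a mu).
Proof.
apply: continuous_exp; apply: continuous_mul; last exact: continuous_cst.
have -> : (fun x : 'cV[R]_d => - (\sum_j a j * (x j 0 - mu j) ^+ 2)) =
    fun x => 0 - \sum_j a j * ((x j 0 - mu j) * (x j 0 - mu j)).
  by apply/funext => x; rewrite sub0r; congr (- _); apply: eq_bigr.
apply: continuous_sub; first exact: continuous_cst.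
apply: continuous_sumf => j; apply: continuous_mul; first exact: continuous_cst.
by apply: continuous_mul; exact: continuous_coord.
Qed.

Lemma is_derive_line_coord (R : realType) d (x u : 'cV[R]_d) j m (t : R) :
  is_derive t 1 (fun t => (x + t *: u) j 0 - m) (u j 0).
Proof.
have -> : (fun t => (x + t *: u) j 0 - m) = fun t => (x j 0 - m) + t * u j 0.
  by apply/funext => s; rewrite !mxE addrAC.
by apply: is_derive_eq; rewrite /GRing.scale /=; ring.
Qed.

Lemma is_derive_line_gauss (R : realType) d (a mu : 'I_d -> R) x u (t : R) :
  is_derive t 1 (fun t => gauss a mu (x + t *: u))
    (pairing (gauss_grad a mu (x + t *: u)) u).
Proof.
have D j : is_derive t 1 (fun t => a j * ((x + t *: u) j 0 - mu j) ^+ 2)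
    (2 * (a j * ((x + t *: u) j 0 - mu j)) * u j 0).
  have := is_derive_line_coord x u j (mu j) t => ?.
  by apply: is_derive_eq; rewrite /GRing.scale /=; ring.
have /is_deriveN/(is_deriveZ 2^-1) Dq := is_derive_sumf D.
have -> : (fun t => gauss a mu (x + t *: u)) =
    expR \o (2^-1 *: - (fun t => \sum_j a j * ((x + t *: u) j 0 - mu j) ^+ 2)).
  by apply/funext => s; rewrite /gauss /= /GRing.scale /= mulrC.
apply: is_derive_eq; rewrite /pairing /gauss_grad.
have -> : expR ((2^-1 *: - (fun t => \sum_j a j * ((x + t *: u) j 0 - mu j) ^+ 2)) t)
    = gauss a mu (x + t *: u).
  by rewrite /gauss /GRing.scale /= mulrC.
rewrite /GRing.scale /= -sumrN !mulr_sumr; apply: eq_bigr => j _; by field.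
Qed.

Lemma smooth2_gauss (R : realType) d (a mu : 'I_d -> R) :
  smooth2 (gauss a mu) (gauss_grad a mu) (gauss_hess a mu).
Proof.
have ca j : continuous (fun x : 'cV[R]_d => a j * (x j 0 - mu j)).
  by apply: continuous_mul; [exact: continuous_cst|exact: continuous_coord].
split.
- exact: continuous_gauss.
- move=> j; apply: continuous_mul; last exact: continuous_gauss.
  have -> : (fun x : 'cV[R]_d => - (a j * (x j 0 - mu j))) =
      fun x => 0 - a j * (x j 0 - mu j) by apply/funext => x; rewrite sub0r.
  by apply: continuous_sub; [exact: continuous_cst|exact: ca].
- move=> i j; apply: continuous_mul; last exact: continuous_gauss.
  by apply: continuous_sub; [exact: continuous_mul|exact: continuous_cst].
- by move=> x u t; exact: is_derive_line_gauss.
- move=> x u i t; rewrite /gauss_grad.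
  have /(is_deriveZ (- a i)) D1 := is_derive_line_coord x u i (mu i) t.
  have D2 := is_derive_line_gauss a mu x u t.
  set y := x + t *: u in D2 *.
  have DD : is_derive t 1
      ((- a i *: (fun t => (x + t *: u) i 0 - mu i)) *
        (fun t => gauss a mu (x + t *: u)))
      (- a i * (y i 0 - mu i) * pairing (gauss_grad a mu y) u +
       gauss a mu y * (- a i * u i 0)) by exact: is_deriveM D1 D2.
  have -> : (fun t => - (a i * ((x + t *: u) i 0 - mu i)) * gauss a mu (x + t *: u))
      = (- a i *: (fun t => (x + t *: u) i 0 - mu i)) * (fun t => gauss a mu (x + t *: u)).
    by apply/funext => s; rewrite -mulNr.
  suff -> : \sum_j gauss_hess a mu y i j * u j 0 =
      - a i * (y i 0 - mu i) * pairing (gauss_grad a mu y) u +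
      gauss a mu y * (- a i * u i 0) by [].
  rewrite /pairing /gauss_hess mulr_sumr.
  transitivity (\sum_j (a i * (y i 0 - mu i) * (a j * (y j 0 - mu j)) *
      gauss a mu y * u j 0) - a i * gauss a mu y * u i 0).
    rewrite [in RHS](bigD1 i)//= [in LHS](bigD1 i)//= eqxx mulr1n.
    rewrite (eq_bigr (fun j => (a i * (y i 0 - mu i) *
      (a j * (y j 0 - mu j)) * gauss a mu y * u j 0))).
      by ring.
    by move=> j /negbTE ij; rewrite eq_sym ij mulr0n subr0.
  congr (_ + _); last by ring.
  by apply: eq_bigr => j _; rewrite /gauss_grad; ring.
Qed.

Lemma qform_gauss (R : realType) d (a mu : 'I_d -> R) (x u : 'cV[R]_d) :
  qform (gauss_hess a mu x) u =
  ((\sum_j a j * (x j 0 - mu j) * u j 0) ^+ 2 - \sum_j a j * u j 0 ^+ 2) *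
  gauss a mu x.
Proof.
pose v j := a j * (x j 0 - mu j).
rewrite /qform /gauss_hess [(\sum_j _) ^+ 2]expr2 mulr_suml -sumrB mulr_suml.
apply: eq_bigr => i _.
transitivity (\sum_j v i * u i 0 * (v j * u j 0) * gauss a mu x -
    a i * u i 0 ^+ 2 * gauss a mu x).
  rewrite [in RHS](bigD1 i)//= [in LHS](bigD1 i)//= eqxx mulr1n.
  rewrite (eq_bigr (fun j => v i * u i 0 * (v j * u j 0) * gauss a mu x)).
    by rewrite /v; ring.
  by move=> j /negbTE ij; rewrite eq_sym ij mulr0n /v; ring.
by rewrite -mulr_suml -mulr_sumr mulrBl.
Qed.

Lemma smooth2_mixture (R : realType) d (I : finType) (c : I -> R)
    (a mu : I -> 'I_d -> R) :
  smooth2 (mixture c a mu) (mixture_grad c a mu) (mixture_hess c a mu).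
Proof.
have sg i := smooth2_gauss (a i) (mu i).
have DZ (f : R -> R) (k df t : R) :
    is_derive t 1 f df -> is_derive t 1 (fun t => k * f t) (k * df).
  by move=> D; have := is_deriveZ k D.
split.
- apply: continuous_sumf => i; apply: continuous_mul; first exact: continuous_cst.
  exact: (smooth2_cont (sg i)).
- move=> j; apply: continuous_sumf => i.
  apply: continuous_mul; first exact: continuous_cst.
  exact: (smooth2_grad_cont (sg i)).
- move=> k l; apply: continuous_sumf => i.
  apply: continuous_mul; first exact: continuous_cst.
  exact: (smooth2_hess_cont (sg i)).
- move=> x u t.
  have -> : pairing (mixture_grad c a mu (x + t *: u)) u =
      \sum_i c i * pairing (gauss_grad (a i) (mu i) (x + t *: u)) u.
    rewrite /pairing /mixture_grad.
    under eq_bigr do rewrite mulr_suml.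
    rewrite exchange_big; apply: eq_bigr => i _; rewrite mulr_sumr.
    by apply: eq_bigr => j _; rewrite mulrA.
  apply: is_derive_sumf => i; apply: DZ; exact: (smooth2_grad (sg i)).
- move=> x u k t.
  have -> : \sum_l mixture_hess c a mu (x + t *: u) k l * u l 0 =
      \sum_i c i * (\sum_l gauss_hess (a i) (mu i) (x + t *: u) k l * u l 0).
    rewrite /mixture_hess.
    under eq_bigr do rewrite mulr_suml.
    rewrite exchange_big; apply: eq_bigr => i _; rewrite mulr_sumr.
    by apply: eq_bigr => j _; rewrite mulrA.
  apply: is_derive_sumf => i; apply: DZ; exact: (smooth2_hess (sg i)).
Qed.

(** * Products *)

Definition split_case (T : Type) (m n : nat) (f : 'I_m -> T) (g : 'I_n -> T)
    (j : 'I_(m + n)) : T :=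
  match fintype.split j with inl j => f j | inr j => g j end.

Lemma split_case_l (T : Type) m n (f : 'I_m -> T) (g : 'I_n -> T) j :
  split_case f g (lshift n j) = f j.
Proof. by rewrite /split_case (unsplitK (inl j)). Qed.

Lemma split_case_r (T : Type) m n (f : 'I_m -> T) (g : 'I_n -> T) j :
  split_case f g (rshift m j) = g j.
Proof. by rewrite /split_case (unsplitK (inr j)). Qed.

Lemma continuous_usubmx (R : realType) m n :
  continuous (usubmx : 'cV[R]_(m + n) -> 'cV[R]_m).
Proof.
move=> x A /nbhs_colP[e e0 eA]; apply/nbhs_colP; exists e => // y xy.
by apply: eA => j; rewrite !mxE.
Qed.

Lemma continuous_dsubmx (R : realType) m n :
  continuous (dsubmx : 'cV[R]_(m + n) -> 'cV[R]_n).
Proof.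
move=> x A /nbhs_colP[e e0 eA]; apply/nbhs_colP; exists e => // y xy.
by apply: eA => j; rewrite !mxE.
Qed.

Lemma sqnorm_split (R : realType) m n (z : 'cV[R]_(m + n)) :
  sqnorm z = sqnorm (usubmx z) + sqnorm (dsubmx z).
Proof.
rewrite /sqnorm big_split_ord; congr (_ + _).
  by apply: eq_bigr => j _; rewrite mxE.
by apply: eq_bigr => j _; rewrite mxE.
Qed.

Section Product.
Context {R : realType} {d1 d2 : nat}.
Variables (f1 : 'cV[R]_d1 -> R) (g1 : 'cV[R]_d1 -> 'I_d1 -> R).
Variable h1 : 'cV[R]_d1 -> 'I_d1 -> 'I_d1 -> R.
Variables (f2 : 'cV[R]_d2 -> R) (g2 : 'cV[R]_d2 -> 'I_d2 -> R).
Variable h2 : 'cV[R]_d2 -> 'I_d2 -> 'I_d2 -> R.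
Implicit Types z w : 'cV[R]_(d1 + d2).

Definition prod_fun z : R := f1 (usubmx z) * f2 (dsubmx z).

Definition prod_grad z : 'I_(d1 + d2) -> R :=
  split_case (fun j => g1 (usubmx z) j * f2 (dsubmx z))
             (fun j => f1 (usubmx z) * g2 (dsubmx z) j).

Definition prod_hess z : 'I_(d1 + d2) -> 'I_(d1 + d2) -> R :=
  split_case
    (fun i => split_case (fun j => h1 (usubmx z) i j * f2 (dsubmx z))
                         (fun j => g1 (usubmx z) i * g2 (dsubmx z) j))
    (fun i => split_case (fun j => g1 (usubmx z) j * g2 (dsubmx z) i)
                         (fun j => f1 (usubmx z) * h2 (dsubmx z) i j)).

Lemma pairing_prod z w :
  pairing (prod_grad z) w =
  pairing (g1 (usubmx z)) (usubmx w) * f2 (dsubmx z) +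
  f1 (usubmx z) * pairing (g2 (dsubmx z)) (dsubmx w).
Proof.
rewrite /pairing big_split_ord mulr_suml mulr_sumr; congr (_ + _).
  by apply: eq_bigr => j _; rewrite /prod_grad split_case_l mxE; ring.
by apply: eq_bigr => j _; rewrite /prod_grad split_case_r mxE; ring.
Qed.

Lemma prod_hess_row_l z w i :
  \sum_j prod_hess z (lshift d2 i) j * w j 0 =
  (\sum_j h1 (usubmx z) i j * usubmx w j 0) * f2 (dsubmx z) +
  g1 (usubmx z) i * pairing (g2 (dsubmx z)) (dsubmx w).
Proof.
rewrite /pairing big_split_ord mulr_suml mulr_sumr; congr (_ + _).
  by apply: eq_bigr => j _; rewrite /prod_hess !split_case_l mxE; ring.
by apply: eq_bigr => j _; rewrite /prod_hess split_case_l split_case_r mxE; ring.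
Qed.

Lemma prod_hess_row_r z w i :
  \sum_j prod_hess z (rshift d1 i) j * w j 0 =
  pairing (g1 (usubmx z)) (usubmx w) * g2 (dsubmx z) i +
  f1 (usubmx z) * (\sum_j h2 (dsubmx z) i j * dsubmx w j 0).
Proof.
rewrite /pairing big_split_ord mulr_suml mulr_sumr; congr (_ + _).
  by apply: eq_bigr => j _; rewrite /prod_hess split_case_r split_case_l mxE; ring.
by apply: eq_bigr => j _; rewrite /prod_hess !split_case_r mxE; ring.
Qed.

Lemma qform_rows d (h : 'I_d -> 'I_d -> R) u :
  qform h u = pairing (fun i => \sum_j h i j * u j 0) u.
Proof.
rewrite /qform /pairing; apply: eq_bigr => i _; rewrite mulr_suml.
by apply: eq_bigr => j _; ring.
Qed.

Lemma qform_prod z w :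
  qform (prod_hess z) w =
  qform (h1 (usubmx z)) (usubmx w) * f2 (dsubmx z) +
  2 * (pairing (g1 (usubmx z)) (usubmx w) * pairing (g2 (dsubmx z)) (dsubmx w)) +
  f1 (usubmx z) * qform (h2 (dsubmx z)) (dsubmx w).
Proof.
rewrite !qform_rows {1}/pairing big_split_ord /=.
set P1 := pairing (g1 _) _; set P2 := pairing (g2 _) _.
have -> : \sum_i (\sum_j prod_hess z (lshift d2 i) j * w j 0) *
      w (lshift d2 i) 0 =
    pairing (fun i => \sum_j h1 (usubmx z) i j * usubmx w j 0) (usubmx w) *
      f2 (dsubmx z) + P1 * P2.
  rewrite /P1 /pairing !mulr_suml -big_split; apply: eq_bigr => i _.
  by rewrite prod_hess_row_l -/P2 [usubmx w i 0]mxE /=; ring.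
have -> : \sum_i (\sum_j prod_hess z (rshift d1 i) j * w j 0) *
      w (rshift d1 i) 0 =
    P1 * P2 + f1 (usubmx z) *
      pairing (fun i => \sum_j h2 (dsubmx z) i j * dsubmx w j 0) (dsubmx w).
  rewrite /P2 /pairing !mulr_sumr -big_split; apply: eq_bigr => i _.
  by rewrite prod_hess_row_r -/P1 [dsubmx w i 0]mxE /=; ring.
by ring.
Qed.

Hypothesis sf1 : smooth2 f1 g1 h1.
Hypothesis sf2 : smooth2 f2 g2 h2.

Lemma smooth2_prod : smooth2 prod_fun prod_grad prod_hess.
Proof.
have cu (F : 'cV[R]_d1 -> R) : continuous F ->
    continuous (fun z : 'cV[R]_(d1 + d2) => F (usubmx z)).
  by move=> cF z; apply: (@continuous_comp _ _ _ usubmx F);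
    [exact: continuous_usubmx|exact: cF].
have cd (F : 'cV[R]_d2 -> R) : continuous F ->
    continuous (fun z : 'cV[R]_(d1 + d2) => F (dsubmx z)).
  by move=> cF z; apply: (@continuous_comp _ _ _ dsubmx F);
    [exact: continuous_dsubmx|exact: cF].
have uline (z w : 'cV[R]_(d1 + d2)) (t : R) :
  usubmx (z + t *: w) = usubmx z + t *: usubmx w by apply/colP => j; rewrite !mxE.
have dline (z w : 'cV[R]_(d1 + d2)) (t : R) :
  dsubmx (z + t *: w) = dsubmx z + t *: dsubmx w by apply/colP => j; rewrite !mxE.
have DM (p q : R -> R) (dp dq t D : R) : is_derive t 1 p dp ->
    is_derive t 1 q dq -> D = dp * q t + p t * dq ->
    is_derive t 1 (fun t => p t * q t) D.
  move=> Dp Dq ->; have := is_deriveM Dp Dq; rewrite addrC [dp * _]mulrC.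
  exact.
split.
- exact (continuous_mul (cu _ (smooth2_cont sf1)) (cd _ (smooth2_cont sf2))).
- move=> j; rewrite /prod_grad /split_case; case: (fintype.split j) => i /=.
    exact (continuous_mul (cu _ (smooth2_grad_cont sf1 i)) (cd _ (smooth2_cont sf2))).
  exact (continuous_mul (cu _ (smooth2_cont sf1)) (cd _ (smooth2_grad_cont sf2 i))).
- move=> k l; rewrite /prod_hess /split_case.
  case: (fintype.split k) => i; case: (fintype.split l) => j /=.
  + exact (continuous_mul (cu _ (smooth2_hess_cont sf1 i j)) (cd _ (smooth2_cont sf2))).
  + exact (continuous_mul (cu _ (smooth2_grad_cont sf1 i)) (cd _ (smooth2_grad_cont sf2 j))).
  + exact (continuous_mul (cu _ (smooth2_grad_cont sf1 j)) (cd _ (smooth2_grad_cont sf2 i))).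
  + exact (continuous_mul (cu _ (smooth2_cont sf1)) (cd _ (smooth2_hess_cont sf2 i j))).
- move=> z w t; rewrite pairing_prod /prod_fun.
  have -> : (fun t => f1 (usubmx (z + t *: w)) * f2 (dsubmx (z + t *: w))) =
      fun t => f1 (usubmx z + t *: usubmx w) * f2 (dsubmx z + t *: dsubmx w).
    by apply/funext => s; rewrite uline dline.
  apply: DM; [exact: smooth2_grad sf1 _ _ t|exact: smooth2_grad sf2 _ _ t|].
  by rewrite uline dline.
- move=> z w k t; case: (split_ordP k) => i ->.
    rewrite prod_hess_row_l.
    have -> : (fun t => prod_grad (z + t *: w) (lshift d2 i)) = fun t =>
        g1 (usubmx z + t *: usubmx w) i * f2 (dsubmx z + t *: dsubmx w).
      by apply/funext => s; rewrite /prod_grad split_case_l uline dline.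
    apply: DM; [exact: smooth2_hess sf1 _ _ i t|exact: smooth2_grad sf2 _ _ t|].
    by rewrite uline dline.
  rewrite prod_hess_row_r.
  have -> : (fun t => prod_grad (z + t *: w) (rshift d1 i)) = fun t =>
      f1 (usubmx z + t *: usubmx w) * g2 (dsubmx z + t *: dsubmx w) i.
    by apply/funext => s; rewrite /prod_grad split_case_r uline dline.
  apply: DM; [exact: smooth2_grad sf1 _ _ t|exact: smooth2_hess sf2 _ _ i t|].
  by rewrite uline dline.
Qed.

Hypothesis f1_gt0 : forall x, 0 < f1 x.
Hypothesis f2_gt0 : forall x, 0 < f2 x.

Lemma critical_prod z : critical prod_grad z <->
  critical g1 (usubmx z) /\ critical g2 (dsubmx z).
Proof.
split=> [cz|[c1 c2] k].
  split=> j; apply/eqP.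
    have /eqP := cz (lshift d2 j); rewrite /prod_grad split_case_l mulf_eq0.
    by rewrite (gt_eqF (f2_gt0 _)) orbF.
  have /eqP := cz (rshift d1 j); rewrite /prod_grad split_case_r mulf_eq0.
  by rewrite (gt_eqF (f1_gt0 _)).
case: (split_ordP k) => i ->; rewrite /prod_grad.
  by rewrite split_case_l c1 mul0r.
by rewrite split_case_r c2 mulr0.
Qed.

Lemma hess_prod_critical z w : critical g1 (usubmx z) ->
  qform (prod_hess z) w =
  qform (h1 (usubmx z)) (usubmx w) * f2 (dsubmx z) +
  f1 (usubmx z) * qform (h2 (dsubmx z)) (dsubmx w).
Proof.
move=> c1; rewrite qform_prod.
have -> : pairing (g1 (usubmx z)) (usubmx w) = 0.
  by rewrite /pairing big1// => j _; rewrite c1 mul0r.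
by rewrite mul0r mulr0 addr0.
Qed.

Lemma hess_lt0_prod z : critical g1 (usubmx z) ->
  hess_lt0 h1 (usubmx z) -> hess_lt0 h2 (dsubmx z) -> hess_lt0 prod_hess z.
Proof.
move=> c1 [l1 l10 H1] [l2 l20 H2].
have F1 := f1_gt0 (usubmx z); have F2 := f2_gt0 (dsubmx z).
set m := Num.min (l1 * f2 (dsubmx z)) (l2 * f1 (usubmx z)).
exists m => [|w]; first by rewrite lt_min !mulr_gt0.
have m1 : m <= l1 * f2 (dsubmx z) by rewrite ge_min lexx.
have m2 : m <= l2 * f1 (usubmx z) by rewrite ge_min lexx orbT.
rewrite hess_prod_critical// sqnorm_split mulrDr lerD//.
  apply: (@le_trans _ _ (- l1 * sqnorm (usubmx w) * f2 (dsubmx z))).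
    by rewrite ler_pM2r.
  by rewrite mulrAC ler_wpM2r ?sqnorm_ge0// mulNr lerN2.
apply: (@le_trans _ _ (f1 (usubmx z) * (- l2 * sqnorm (dsubmx w)))).
  by rewrite ler_pM2l.
by rewrite mulrA ler_wpM2r ?sqnorm_ge0// mulrN lerN2 mulrC.
Qed.

Lemma nondegenerate_prod : nondegenerate g1 h1 -> nondegenerate g2 h2 ->
  nondegenerate prod_grad prod_hess.
Proof.
have F1 := f1_gt0; have F2 := f2_gt0.
have q0 d (h : 'I_d -> 'I_d -> R) : qform h 0 = 0.
  by rewrite /qform big1// => i _; rewrite big1// => j _; rewrite !mxE !mulr0.
move=> n1 n2 z /critical_prod[c1 c2] hz; apply: hess_lt0_prod => //.
  apply: n1 => // u; have := hz (col_mx u 0).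
  rewrite hess_prod_critical// col_mxKu col_mxKd q0 mulr0 addr0.
  by rewrite pmulr_lle0.
apply: n2 => // u; have := hz (col_mx 0 u).
rewrite hess_prod_critical// col_mxKu col_mxKd q0 mul0r add0r.
by rewrite pmulr_rle0.
Qed.

End Product.

(** * Mixtures with many nondegenerate modes *)

(** Some mixture of [k] components in dimension [d] has [N] nondegenerate modes.
Nondegeneracy of all critical points with nonpositive Hessian is part of the
notion: it is what survives products and perturbations that are small with their
first two derivatives, and it makes the set of modes finite. *)
Definition attains (R : realType) (d k N : nat) : Prop :=
  exists (I : finType) (c : I -> R) (a mu : I -> 'I_d -> R) g h,
    [/\ #|I| = k, forall i, 0 < c i, forall i j, 0 < a i j,
        smooth2 (mixture c a mu) g h & nondegenerate g h] /\
    exists X : 'I_N -> 'cV[R]_d,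
      injective X /\ forall n, critical g (X n) /\ hess_lt0 h (X n).

(** Outside the cube of half-side [M] every component decreases along the ray
from the origin. The condition is homogeneous in [a], so that it is uniform in
the width of an isotropic component. *)
Definition confined (R : realType) (d : nat) (I : finType) (M : R)
    (a mu : I -> 'I_d -> R) :=
  forall i j, \sum_k a i k * mu i k ^+ 2 < a i j * M ^+ 2.

Lemma exists_confined (R : realType) d (I : finType) (a mu : I -> 'I_d -> R) :
  (forall i j, 0 < a i j) -> exists2 M, 0 < M & confined M a mu.
Proof.
move=> a0.
pose S i := \sum_k a i k * mu i k ^+ 2.
have S0 i : 0 <= S i.
  by apply: sumr_ge0 => k _; rewrite mulr_ge0 ?sqr_ge0// ltW.
have T0 i j : 0 <= S i / a i j by rewrite divr_ge0// ltW.
pose M := 1 + \sum_i \sum_j S i / a i j.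
have M1 : 1 <= M by rewrite lerDl sumr_ge0// => i _; exact: sumr_ge0.
exists M => [|i j]; first by rewrite (lt_le_trans ltr01).
rewrite -/(S i) mulrC -ltr_pdivrMr//.
apply: (@lt_le_trans _ _ M); last by rewrite expr2 ler_peMl// (le_trans ler01).
rewrite /M addrC ltr_pwDr// (bigD1 i)//= (bigD1 j)//= -addrA lerDl addr_ge0//.
  exact: sumr_ge0.
by apply: sumr_ge0 => k _; exact: sumr_ge0.
Qed.

Lemma confined_widen (R : realType) d (I : finType) (M M' : R)
    (a mu : I -> 'I_d -> R) : (forall i j, 0 < a i j) -> 0 <= M -> M <= M' ->
  confined M a mu -> confined M' a mu.
Proof.
move=> a0 M0 MM' cM i j; apply: lt_le_trans (cM i j) _.
by rewrite ler_pM2l// ler_sqr// nnegrE// (le_trans M0).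
Qed.

Lemma confined_inward (R : realType) d (I : finType) (M : R) (c : I -> R)
    (a mu : I -> 'I_d -> R) (x : 'cV[R]_d) (i0 : I) (j0 : 'I_d) :
  (forall i, 0 < c i) -> (forall i j, 0 < a i j) -> 0 <= M ->
  confined M a mu -> M <= `|x j0 0| -> pairing (mixture_grad c a mu x) x < 0.
Proof.
move=> c0 a0 M0 cM Mx.
have -> : pairing (mixture_grad c a mu x) x =
    - \sum_i c i * gauss (a i) (mu i) x * (\sum_j a i j * (x j 0 - mu i j) * x j 0).
  rewrite /pairing /mixture_grad -sumrN.
  under eq_bigr do rewrite mulr_suml.
  rewrite exchange_big; apply: eq_bigr => i _; rewrite mulr_sumr -sumrN.
  by apply: eq_bigr => j _; rewrite /gauss_grad; ring.
have pos i : 0 < \sum_j a i j * (x j 0 - mu i j) * x j 0.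
  (* coordinatewise, (x - m) x >= (x ^ 2 - m ^ 2) / 2 *)
  apply: (@lt_le_trans _ _ (\sum_j (a i j * x j 0 ^+ 2 - a i j * mu i j ^+ 2) / 2)).
    rewrite -mulr_suml divr_gt0// sumrB subr_gt0 (lt_le_trans (cM i j0))//.
    rewrite (bigD1 j0)//= -[x j0 0 ^+ 2]real_normK ?num_real//.
    apply: (@le_trans _ _ (a i j0 * `|x j0 0| ^+ 2)).
      by rewrite ler_pM2l// ler_sqr ?nnegrE.
    by rewrite lerDl sumr_ge0// => j _; rewrite mulr_ge0 ?sqr_ge0// ltW.
  apply: ler_sum => j _; rewrite -subr_ge0.
  have -> : a i j * (x j 0 - mu i j) * x j 0 -
      (a i j * x j 0 ^+ 2 - a i j * mu i j ^+ 2) / 2 =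
    a i j * (x j 0 - mu i j) ^+ 2 / 2 by field.
  by rewrite divr_ge0// mulr_ge0 ?sqr_ge0// ltW.
rewrite oppr_lt0 (bigD1 i0)//= ltr_wpDr ?mulr_gt0 ?gauss_gt0//.
by apply: sumr_ge0 => i _; rewrite ltW// !mulr_gt0 ?gauss_gt0.
Qed.

Lemma critical_confined (R : realType) d (I : finType) (M : R) (c : I -> R)
    (a mu : I -> 'I_d -> R) g h (x : 'cV[R]_d) (i0 : I) (j : 'I_d) :
  (forall i, 0 < c i) -> (forall i j, 0 < a i j) -> 0 <= M -> confined M a mu ->
  smooth2 (mixture c a mu) g h -> critical g x -> `|x j 0| < M.
Proof.
move=> c0 a0 M0 cM sg cx; rewrite ltNge; apply/negP => Mx.
have := confined_inward i0 c0 a0 M0 cM Mx.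
rewrite (smooth2_grad_unique x x (smooth2_mixture c a mu) sg).
by rewrite /pairing big1 ?ltxx// => k _; rewrite cx mul0r.
Qed.

Lemma mixture_gt0 (R : realType) d (I : finType) (c : I -> R)
    (a mu : I -> 'I_d -> R) (x : 'cV[R]_d) (i0 : I) :
  (forall i, 0 < c i) -> 0 < mixture c a mu x.
Proof.
move=> c0; rewrite /mixture (bigD1 i0)//= ltr_wpDr ?mulr_gt0 ?gauss_gt0//.
by apply: sumr_ge0 => i _; rewrite ltW// mulr_gt0 ?gauss_gt0.
Qed.

Lemma attains_0 (R : realType) : attains R 0 1 1.
Proof.
pose c (_ : unit) : R := 1.
pose a (_ : unit) (_ : 'I_0) : R := 1.
exists unit, c, a, a, (mixture_grad c a a), (mixture_hess c a a).
have neg (h : 'cV[R]_0 -> 'I_0 -> 'I_0 -> R) x : hess_lt0 h x.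
  by exists 1 => // u; rewrite /qform /sqnorm !big_ord0 mulr0.
split; first split => //; first by rewrite card_unit.
  exact: smooth2_mixture.
exists (fun=> 0); split; first by move=> i j _; rewrite !ord1.
by move=> n; split => // -[].
Qed.

Lemma gauss_split (R : realType) m n (a1 mu1 : 'I_m -> R) (a2 mu2 : 'I_n -> R)
    (z : 'cV[R]_(m + n)) :
  gauss (split_case a1 a2) (split_case mu1 mu2) z =
  gauss a1 mu1 (usubmx z) * gauss a2 mu2 (dsubmx z).
Proof.
rewrite /gauss big_split_ord opprD mulrDl expRD.
congr (expR (- _ / 2) * expR (- _ / 2)).
  by apply: eq_bigr => j _; rewrite !split_case_l mxE.
by apply: eq_bigr => j _; rewrite !split_case_r mxE.
Qed.

(** The factors are positive, so the critical points of the product are the pairs of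
critical points, and there the Hessian of the product is block diagonal. *)
Lemma attains_mul (R : realType) d1 d2 k1 k2 N1 N2 : (0 < k1)%N -> (0 < k2)%N ->
  attains R d1 k1 N1 -> attains R d2 k2 N2 ->
  attains R (d1 + d2) (k1 * k2) (N1 * N2).
Proof.
move=> k10 k20.
move=> [I1 [c1 [a1 [mu1 [g1 [h1 [[I1k c10 a10 s1 n1] [X1 [X1inj X1P]]]]]]]]].
move=> [I2 [c2 [a2 [mu2 [g2 [h2 [[I2k c20 a20 s2 n2] [X2 [X2inj X2P]]]]]]]]].
have /card_gt0P[i1 _] : (0 < #|I1|)%N by rewrite I1k.
have /card_gt0P[i2 _] : (0 < #|I2|)%N by rewrite I2k.
pose f1 := mixture c1 a1 mu1; pose f2 := mixture c2 a2 mu2.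
have f10 x : 0 < f1 x by exact: mixture_gt0 i1 c10.
have f20 x : 0 < f2 x by exact: mixture_gt0 i2 c20.
pose c (i : I1 * I2) := c1 i.1 * c2 i.2.
pose a (i : I1 * I2) := split_case (a1 i.1) (a2 i.2).
pose mu (i : I1 * I2) := split_case (mu1 i.1) (mu2 i.2).
have fE : mixture c a mu = prod_fun f1 f2.
  apply/funext => z; rewrite /mixture /prod_fun /f1 /f2 /mixture big_distrl /=.
  under [RHS]eq_bigr do rewrite big_distrr.
  rewrite pair_big; apply: eq_bigr => i _; rewrite gauss_split /c.
  by rewrite mulrACA.
exists (I1 * I2)%type, c, a, mu, (prod_grad f1 g1 f2 g2).
exists (prod_hess f1 g1 h1 f2 g2 h2); split; first split.
- by rewrite card_prod I1k I2k.
- by move=> i; exact: mulr_gt0.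
- by move=> i j; rewrite /a /split_case; case: (fintype.split j).
- by rewrite fE; exact: smooth2_prod.
- exact: nondegenerate_prod.
have card_eq : #|{: 'I_N1 * 'I_N2}| = (N1 * N2)%N by rewrite card_prod !card_ord.
pose p (n : 'I_(N1 * N2)) : 'I_N1 * 'I_N2 := enum_val (cast_ord (esym card_eq) n).
exists (fun n => col_mx (X1 (p n).1) (X2 (p n).2)); split.
  move=> n n' /eq_col_mx[/X1inj e1 /X2inj e2].
  have : p n = p n' by rewrite [p n]surjective_pairing e1 e2 -surjective_pairing.
  by move/enum_val_inj/cast_ord_inj.
move=> n; have [cr1 hs1] := X1P (p n).1; have [cr2 hs2] := X2P (p n).2.
split; first by apply/critical_prod => //; rewrite col_mxKu col_mxKd.
by apply: hess_lt0_prod => //; rewrite ?col_mxKu ?col_mxKd.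
Qed.

(** * Adding a narrow component *)

Section Spike.
Context {R : realType} {d : nat}.
Variable p : 'cV[R]_d.
Implicit Types (x y u : 'cV[R]_d) (tau : R).

Definition spike tau : 'cV[R]_d -> R := gauss (fun=> tau) (fun j => p j 0).
Definition spike_grad tau : 'cV[R]_d -> 'I_d -> R :=
  gauss_grad (fun=> tau) (fun j => p j 0).
Definition spike_hess tau : 'cV[R]_d -> 'I_d -> 'I_d -> R :=
  gauss_hess (fun=> tau) (fun j => p j 0).

Lemma spikeE tau y : spike tau y = expR (- (tau * sqnorm (y - p)) / 2).
Proof.
rewrite /spike /gauss /sqnorm mulr_sumr; congr (expR (- _ / 2)).
by apply: eq_bigr => j _; rewrite !mxE.
Qed.

Lemma qform_spike tau y u :
  qform (spike_hess tau y) u =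
  (tau ^+ 2 * (\sum_j (y - p) j 0 * u j 0) ^+ 2 - tau * sqnorm u) * spike tau y.
Proof.
rewrite qform_gauss -mulr_sumr -exprMn; congr ((_ ^+ 2 - _) * _).
by rewrite mulr_sumr; apply: eq_bigr => j _; rewrite !mxE mulrA.
Qed.

Lemma sumM_sqr_le (v u : 'cV[R]_d) :
  (\sum_j v j 0 * u j 0) ^+ 2 <= sqnorm v * sqnorm u.
Proof.
have := @cauchy_schwarz_weighted R _ (fun=> 1) (fun j => v j 0) (fun j => u j 0)
  (fun=> ltr01).
under [X in _ <= X * _]eq_bigr do rewrite divr1.
by under [X in _ <= _ * X]eq_bigr do rewrite mul1r.
Qed.

Lemma continuous_sqdist : continuous (fun y => sqnorm (y - p)).
Proof.
have -> : (fun y => sqnorm (y - p)) =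
    fun y => \sum_j (y j 0 - p j 0) * (y j 0 - p j 0).
  by apply/funext => y; apply: eq_bigr => j _; rewrite !mxE expr2.
by apply: continuous_sumf => j; apply: continuous_mul; exact: continuous_coord.
Qed.

(** Away from [p] the spike is C^2-small: a Gaussian tail beats the factor
[tau ^ 2] of the second derivatives. *)
Lemma spike_far x (e : R) : x != p -> 0 < e ->
  exists T : R, \forall y \near x, forall tau, T < tau ->
    1 <= tau /\ tau ^+ 2 * (1 + sqnorm (y - p)) * spike tau y < e.
Proof.
move=> xp e0; pose r := sqnorm (x - p) / 2; pose S := sqnorm (x - p) + 1.
have s0 : 0 < sqnorm (x - p) by rewrite sqnorm_gt0// subr_eq0.
have r0 : 0 < r by rewrite divr_gt0.
exists (Num.max 1 ((1 + S) * 216 / (r ^+ 3 * e))).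
have near_gt : \forall y \near x, r < sqnorm (y - p).
  by apply: (continuous_near_gt continuous_sqdist); rewrite /r; lra.
have near_lt : \forall y \near x, sqnorm (y - p) < S.
  by apply: (continuous_near_lt continuous_sqdist); rewrite /S; lra.
apply: filterS2 near_gt near_lt => y ry yS tau.
rewrite gt_max => /andP[tau1 tauT]; split; first exact: ltW.
have tau0 : 0 < tau by rewrite (lt_trans ltr01).
set s := sqnorm (y - p) in ry yS *.
have tr0 : 0 < tau * r by rewrite mulr_gt0.
pose z := tau * r / 6.
have z0 : 0 < z by rewrite /z divr_gt0.
have B_le : spike tau y <= (z ^+ 3)^-1.
  rewrite spikeE -/s mulNr expRN lef_pV2 ?posrE ?exprn_gt0 ?expR_gt0//.
  (* exp w >= (1 + w / 3) ^ 3 is cubic in tau *)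
  have -> : tau * s / 2 = 3%:R * (tau * s / 6) by field.
  rewrite expRM_natl lerXn2r ?nnegrE ?ltW ?expR_gt0//.
  apply: (@lt_le_trans _ _ (1 + tau * s / 6)); last exact: expR_ge1Dx.
  have : tau * r <= tau * s by rewrite ler_pM2l// ltW.
  rewrite /z; lra.
apply: (@le_lt_trans _ _ (tau ^+ 2 * (1 + S) * (z ^+ 3)^-1)).
  apply: ler_pM => //; first by rewrite mulr_ge0 ?sqr_ge0 ?addr_ge0 ?sqnorm_ge0.
    exact/ltW/gauss_gt0.
  by rewrite ler_wpM2l ?sqr_ge0// lerD2l ltW.
have -> : tau ^+ 2 * (1 + S) * (z ^+ 3)^-1 = (1 + S) * 216 / r ^+ 3 / tau.
  by rewrite /z; field; rewrite !gt_eqF.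
rewrite ltr_pdivrMr//.
move: tauT; rewrite ltr_pdivrMr ?mulr_gt0 ?exprn_gt0// => tauT.
rewrite ltr_pdivrMr ?exprn_gt0//.
by have -> : e * tau * r ^+ 3 = tau * (r ^+ 3 * e) by ring.
Qed.

Context {f : 'cV[R]_d -> R} {g : 'cV[R]_d -> 'I_d -> R}.
Context {h : 'cV[R]_d -> 'I_d -> 'I_d -> R}.
Hypothesis sf : smooth2 f g h.

Definition sum_grad tau y j : R := g y j + spike_grad tau y j.
Definition sum_hess tau y i j : R := h y i j + spike_hess tau y i j.

Lemma smooth2_sum tau :
  smooth2 (fun y => f y + spike tau y) (sum_grad tau) (sum_hess tau).
Proof.
have sg := smooth2_gauss (fun=> tau) (fun j => p j 0).
split.
- exact (continuous_add (smooth2_cont sf) (smooth2_cont sg)).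
- move=> j; exact (continuous_add (smooth2_grad_cont sf j) (smooth2_grad_cont sg j)).
- move=> i j.
  exact (continuous_add (smooth2_hess_cont sf i j) (smooth2_hess_cont sg i j)).
- move=> x u t.
  have -> : pairing (sum_grad tau (x + t *: u)) u =
      pairing (g (x + t *: u)) u + pairing (spike_grad tau (x + t *: u)) u.
    by rewrite /pairing -big_split; apply: eq_bigr => j _; rewrite mulrDl.
  exact (is_deriveD (smooth2_grad sf x u t) (smooth2_grad sg x u t)).
- move=> x u i t.
  have -> : \sum_j sum_hess tau (x + t *: u) i j * u j 0 =
      \sum_j h (x + t *: u) i j * u j 0 +
      \sum_j spike_hess tau (x + t *: u) i j * u j 0.
    by rewrite -big_split; apply: eq_bigr => j _; rewrite mulrDl.
  exact (is_deriveD (smooth2_hess sf x u i t) (smooth2_hess sg x u i t)).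
Qed.

Definition nondegenerate_at tau y := critical (sum_grad tau) y -> hess_le0 (sum_hess tau) y ->
  hess_lt0 (sum_hess tau) y.

(** At a critical point close to [p] the gradient of the bump cancels that of [f],
so its norm is bounded away from 0 and from above.
Testing the Hessian against [y - p] itself then confines the point to
[tau |y - p| ^ 2 <= 2], where the bump is higher than [exp (- 1)] and the
negative term [- tau |u| ^ 2] of its Hessian beats everything else. *)
Lemma nondegenerate_near : ~ critical g p ->
  exists T : R, \forall y \near p, forall tau, T < tau -> nondegenerate_at tau y.
Proof.
move=> /existsNP[j0 /eqP gp].
pose kap := `|g p j0| / 2; pose K1 := \sum_j g p j ^+ 2 + 1.
pose K := \sum_i \sum_j `|h p i j| + 1; pose b : R := expR (- 1).
have kap0 : 0 < kap by rewrite divr_gt0 ?normr_gt0.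
have K0 : 0 < K.
  by apply: ltr_wpDl => //; apply: sumr_ge0 => i _; exact: sumr_ge0.
have b0 : 0 < b by exact: expR_gt0.
exists (Num.max 1 ((K + K1 / b + 1) / b)).
have E1 : \forall y \near p, kap < `|g y j0|.
  apply: (continuous_near_gt (continuous_abs (smooth2_grad_cont sf j0))).
  by rewrite /kap ltr_pdivrMr// ltr_pMr ?normr_gt0// ltr1n.
have E2 : \forall y \near p, \sum_j g y j * g y j < K1.
  apply: (@continuous_near_lt _ _ (fun y => \sum_j g y j * g y j)).
    apply: continuous_sumf => j.
    exact (continuous_mul (smooth2_grad_cont sf j) (smooth2_grad_cont sf j)).
  by rewrite /K1 (eq_bigr (fun j => g p j ^+ 2)) ?ltrDl// => j _; rewrite expr2.
have E3 : \forall y \near p, \sum_i \sum_j `|h y i j| < K.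
  apply: (@continuous_near_lt _ _ (fun y => \sum_i \sum_j `|h y i j|)).
    apply: continuous_sumf => i; apply: continuous_sumf => j.
    exact (continuous_abs (smooth2_hess_cont sf i j)).
  by rewrite ltrDl.
have E4 : \forall y \near p, `|(y : 'cV[R]_d) j0 0 - p j0 0| < kap / K.
  apply: (continuous_near_lt (continuous_abs (@continuous_coord _ _ j0 (p j0 0)))).
  by rewrite subrr normr0 divr_gt0.
apply: filterS2 (filterI E1 E2) (filterI E3 E4) => y [g_gt g_lt] [h_lt y_lt] tau.
rewrite gt_max => /andP[tau1 tauT] cy hy.
have tau0 : 0 < tau by rewrite (lt_trans ltr01).
pose v := y - p; pose s := sqnorm v; pose B := spike tau y.
have B0 : 0 < B by exact: gauss_gt0.
have gE j : g y j = tau * v j 0 * B.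
  have /eqP := cy j; rewrite /sum_grad /spike_grad /gauss_grad addr_eq0 mulNr opprK.
  by move=> /eqP ->; rewrite !mxE.
have g2E : \sum_j g y j * g y j = tau ^+ 2 * B ^+ 2 * s.
  by rewrite /s /sqnorm mulr_sumr; apply: eq_bigr => j _; rewrite gE; ring.
have s0 : 0 < s.
  apply: sqnorm_gt0; apply/negP => /eqP v0; move: g_gt.
  by rewrite gE v0 mxE mulr0 mul0r normr0 ltNge ltW.
have hle u : `|qform (h y) u| <= K * sqnorm u.
  apply: le_trans (qform_bound _ _) _; apply: ler_wpM2r; first exact: sqnorm_ge0.
  exact: ltW.
have ts2 : tau * s <= 2.
  have := hy v; rewrite qformD qform_spike.
  have -> : \sum_j (y - p) j 0 * v j 0 = s.
    by apply: eq_bigr => j _; rewrite -expr2.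
  rewrite -/s -/B => hv.
  have hv' : B * tau * (tau * s - 1) <= K.
    have := hle v; rewrite ler_norml => /andP[lo _].
    rewrite -(ler_pM2r s0); rewrite -/s in lo.
    have -> : B * tau * (tau * s - 1) * s = (tau ^+ 2 * s ^+ 2 - tau * s) * B.
      by ring.
    lra.
  rewrite leNgt; apply/negP => ts.
  have m0 : 0 < tau * s - 1 by lra.
  have vj0 : `|g y j0| = tau * B * `|v j0 0|.
    by rewrite gE !normrM (gtr0_norm tau0) (gtr0_norm B0) mulrAC.
  have : `|g y j0| * (tau * s - 1) <= K * `|v j0 0|.
    rewrite vj0 mulrAC; apply: ler_wpM2r => //.
    by rewrite [tau * B]mulrC.
  have : K * `|v j0 0| < kap.
    by rewrite mulrC -ltr_pdivlMr//; move: y_lt; rewrite !mxE.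
  nra.
have Bb : b <= B.
  by rewrite /b /B spikeE -/v -/s ler_expR; lra.
have tB : tau ^+ 2 * s * B <= K1 / b.
  rewrite ler_pdivlMr//; apply: le_trans (ltW g_lt).
  rewrite g2E; have -> : tau ^+ 2 * B ^+ 2 * s = tau ^+ 2 * s * B * B by ring.
  by rewrite ler_wpM2l// !mulr_ge0 ?sqr_ge0 ?ltW.
have tT : 1 <= b * tau - K - K1 / b.
  by move: tauT; rewrite ltr_pdivrMr// [tau * b]mulrC; lra.
exists 1 => // u; rewrite qformD qform_spike -/v -/B.
have := hle u; rewrite ler_norml => /andP[_ hu].
have q1 : tau ^+ 2 * (\sum_j v j 0 * u j 0) ^+ 2 * B <= K1 / b * sqnorm u.
  apply: (@le_trans _ _ (tau ^+ 2 * s * B * sqnorm u)); last first.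
    by rewrite ler_wpM2r ?sqnorm_ge0.
  have -> : tau ^+ 2 * s * B * sqnorm u = tau ^+ 2 * B * (s * sqnorm u) by ring.
  rewrite mulrAC ler_wpM2l ?sumM_sqr_le// mulr_ge0 ?sqr_ge0//; exact: ltW.
have q2 : b * tau * sqnorm u <= tau * sqnorm u * B.
  rewrite -mulrA mulrC ler_wpM2l// mulr_ge0 ?sqnorm_ge0//; exact: ltW.
rewrite mulrBl.
have : sqnorm u <= (b * tau - K - K1 / b) * sqnorm u.
  by rewrite ler_peMl ?sqnorm_ge0.
move: q1 q2 hu; move: (K1 / b) => kb; rewrite !mulrBl; lra.
Qed.

(** Being noncritical, having an ascending second derivative, and being
negative definite are three open conditions on the gradient and the Hessian,
and nondegeneracy says that one of them holds. *)
Lemma nondegenerate_far x : nondegenerate g h -> x != p ->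
  exists T : R, \forall y \near x, forall tau, T < tau -> nondegenerate_at tau y.
Proof.
move=> nd xp.
have small (e : R) : 0 < e -> exists T : R, \forall y \near x,
    forall tau, T < tau ->
    (forall j, `|spike_grad tau y j| < e) /\
    forall u, `|qform (spike_hess tau y) u| <= e * sqnorm u.
  move=> e0; have e20 : 0 < e / 2 by rewrite divr_gt0.
  have [T near_small] := spike_far xp e20; exists T.
  apply: filterS near_small => y yP tau /yP[tau1 small].
  have tau0 : 0 < tau by rewrite (lt_le_trans ltr01).
  set s := sqnorm (y - p) in small; set B := spike tau y in small.
  have s0 : 0 <= s by exact: sqnorm_ge0.
  have B0 : 0 < B by exact: gauss_gt0.
  have ttB : tau * B <= tau ^+ 2 * B by rewrite ler_pM2r// expr2 ler_peMl// ltW.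
  split=> [j|u].
    have vs : `|(y - p) j 0| <= 1 + s.
      have := sqr_coord_le (y - p) j; rewrite -/s.
      rewrite -(real_normK (num_real ((y - p) j 0))).
      by move: `|_| => w; nra.
    rewrite /spike_grad /gauss_grad -/(spike tau y) -/B mulNr normrN !normrM.
    rewrite (gtr0_norm tau0) (gtr0_norm B0).
    have -> : y j 0 - p j 0 = (y - p) j 0 by rewrite !mxE.
    apply: (@le_lt_trans _ _ (tau * B * (1 + s))).
      by rewrite mulrAC ler_wpM2l// mulr_ge0// ltW.
    apply: (@le_lt_trans _ _ (tau ^+ 2 * B * (1 + s))).
      by rewrite ler_wpM2r// addr_ge0.
    by rewrite mulrAC; apply: lt_trans small _; lra.
  rewrite qform_spike -/B.
  have cs := sumM_sqr_le (y - p) u; rewrite -/s in cs.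
  set c := (\sum_j _) ^+ 2 in cs *.
  have c0 : 0 <= c by exact: sqr_ge0.
  have u0 := sqnorm_ge0 u.
  have k0 : 0 <= tau ^+ 2 * B by rewrite mulr_ge0 ?sqr_ge0// ltW.
  have q1 : tau ^+ 2 * B * c <= tau ^+ 2 * B * (s * sqnorm u) by exact: ler_wpM2l.
  have q2 : tau * B * sqnorm u <= tau ^+ 2 * B * sqnorm u by exact: ler_wpM2r.
  have q3 : 0 <= tau ^+ 2 * B * c by exact: mulr_ge0.
  have q4 : 0 <= tau * B * sqnorm u by rewrite !mulr_ge0// ltW.
  have q5 : tau ^+ 2 * (1 + s) * B * sqnorm u <= e / 2 * sqnorm u.
    by rewrite ler_wpM2r// ltW.
  have q6 : 0 <= e * sqnorm u by rewrite mulr_ge0// ltW.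
  rewrite ler_norml; lra.
have [cx|/existsNP[j /eqP gx]] := pselect (critical g x); last first.
  have e0 : 0 < `|g x j| / 2 by rewrite divr_gt0 ?normr_gt0.
  have [T near_small] := small _ e0; exists T.
  have near_g : \forall y \near x, `|g x j| / 2 < `|g y j|.
    apply: (continuous_near_gt (continuous_abs (smooth2_grad_cont sf j))).
    by rewrite ltr_pdivrMr// ltr_pMr ?normr_gt0// ltr1n.
  apply: filterS2 near_g near_small => y gy yP tau /yP[/(_ j) sg _] /(_ j).
  rewrite /sum_grad => /eqP; rewrite addr_eq0 => /eqP E.
  by move: gy; rewrite E normrN ltNge (ltW sg).
have [hx|/existsNP[u /negP]] := pselect (hess_le0 h x); last first.
  rewrite -ltNge => hu; pose e := qform (h x) u / 2 / (1 + sqnorm u).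
  have u1 : 0 < 1 + sqnorm u by rewrite ltr_pwDl ?sqnorm_ge0.
  have e0 : 0 < e by rewrite !divr_gt0.
  have [T near_small] := small _ e0; exists T.
  have near_h : \forall y \near x, qform (h x) u / 2 < qform (h y) u.
    apply: (@continuous_near_gt _ _ (fun y => qform (h y) u)); last by lra.
    apply: continuous_sumf => i; apply: continuous_sumf => j.
    exact (continuous_mul (smooth2_hess_cont sf i j) (@continuous_cst _ _ _)).
  apply: filterS2 near_h near_small => y hy yP tau /yP[_ /(_ u) sh] _ /(_ u).
  rewrite qformD => le0.
  have : e * sqnorm u <= qform (h x) u / 2.
    by rewrite /e mulrAC ler_pdivrMr// ler_pM2l ?divr_gt0// lerDr.
  by move: sh; rewrite ler_norml => /andP[lo _]; lra.
have [lam lam0 hlam] := nd x cx hx.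
have e0 : 0 < lam / 2 / 2 by rewrite !divr_gt0.
have [T near_small] := small _ e0; exists T.
apply: filterS2 (hess_lt0_near sf hlam lam0) near_small => y hy yP.
move=> tau /yP[_ sh] _ _; exists (lam / 2 / 2) => // u; rewrite qformD.
have := sh u; rewrite ler_norml => /andP[_ up]; have := hy u; lra.
Qed.

End Spike.

Lemma near_right0 (R : realType) (P : R -> Prop) (r0 : R) : 0 < r0 ->
  (forall r, 0 < r < r0 -> P r) -> \forall r \near 0^'+, P r.
Proof.
move=> r00 rP; exists r0 => // r /=; rewrite sub0r normrN => rr0 r1.
by apply: rP; rewrite r1 -(gtr0_norm r1).
Qed.

Lemma near_pinfty (R : realType) (P : R -> Prop) (T : R) :
  (forall t, T < t -> P t) -> \forall t \near +oo, P t.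
Proof. by move=> tP; exists T; split => //; exact: num_real. Qed.

(** Stands in for the implicit function theorem: it finds a mode near a given point
from a comparison of values alone. *)
Lemma interior_local_max (R : realType) d (f : 'cV[R]_d -> R) x (r : R) :
  continuous f -> 0 < r ->
  (forall y, box x r y -> (exists j, `|y j 0 - x j 0| = r) -> f y < f x) ->
  exists2 z, local_max f z & forall j, `|z j 0 - x j 0| < r.
Proof.
move=> cf r0 bd.
have xx : box x r x by move=> j; rewrite subrr normr0 ltW.
have [|||z /set_mem zr zmax] := @compact_EVT_max _ R f (box x r).
- by exists x.
- exact: box_compact.
- exact: continuous_subspaceT.
have zin j : `|z j 0 - x j 0| < r.
  rewrite lt_neqAle zr andbT; apply/negP => /eqP zj.
  by have := bd z zr (ex_intro _ j zj); rewrite ltNge (zmax x (mem_set xx)).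
exists z => //.
have : \forall y \near z, forall j, `|(y : 'cV[R]_d) j 0 - x j 0| < r.
  apply: (@filter_forall _ _ (fun j (y : 'cV[R]_d) => `|y j 0 - x j 0| < r)
    (nbhs z)) => j.
  exact: (continuous_near_lt (continuous_abs (@continuous_coord _ _ j (x j 0)))).
by apply: filterS => y yr; apply/zmax/mem_set => j; exact: ltW.
Qed.

Section SpikeModes.
Context {R : realType} {d : nat}.
Variable p : 'cV[R]_d.

Lemma spike_lt (rho e tau : R) y : 0 < rho -> rho <= sqnorm (y - p) -> 0 < e ->
  2 / (rho * e) < tau -> spike p tau y < e.
Proof.
move=> rho0 ry e0; rewrite ltr_pdivrMr ?mulr_gt0// => tau2.
have tau0 : 0 < tau.
  rewrite ltNge; apply/negP => tau0; move: tau2; rewrite ltNge => /negP; apply.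
  by rewrite (@le_trans _ _ 0)// mulr_le0_ge0// ltW ?mulr_gt0.
rewrite spikeE mulNr expRN -[e]invrK ltf_pV2 ?posrE ?expR_gt0 ?invr_gt0//.
apply: lt_le_trans (expR_ge1Dx _).
have : tau * rho <= tau * sqnorm (y - p) by rewrite ler_pM2l.
have : 2 * e^-1 < tau * rho.
  by rewrite -/(2 / e) ltr_pdivrMr// -mulrA.
lra.
Qed.

Context {f : 'cV[R]_d -> R} {g : 'cV[R]_d -> 'I_d -> R}.
Context {h : 'cV[R]_d -> 'I_d -> 'I_d -> R}.
Hypothesis sf : smooth2 f g h.

Definition max_close (x : 'cV[R]_d) (r tau : R) :=
  exists2 z, local_max (fun y => f y + spike p tau y) z &
    forall j, `|z j 0 - x j 0| < r.

Lemma sqnorm_boundary (x y : 'cV[R]_d) (r : R) :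
  (exists j, `|y j 0 - x j 0| = r) -> r ^+ 2 <= sqnorm (y - x).
Proof.
move=> [j <-]; rewrite real_normK ?num_real//.
by have := sqr_coord_le (y - x) j; rewrite !mxE.
Qed.

(** On the boundary of a small cube around a nondegenerate mode the function
stays a definite amount below its central value, more than the spike can make
up for when it is narrow. *)
Lemma max_close_mode x : critical g x -> hess_lt0 h x -> x != p ->
  \forall r \near 0^'+, \forall tau \near +oo, max_close x r tau.
Proof.
move=> cx hx xp; have [lam lam0 decay] := critical_decay sf cx hx.
have s0 : 0 < sqnorm (x - p) by rewrite sqnorm_gt0// subr_eq0.
pose rho := sqnorm (x - p) / 2.
have rho0 : 0 < rho by rewrite divr_gt0.
have far : \forall y \near x, rho < sqnorm (y - p).
  by apply: (continuous_near_gt (@continuous_sqdist R d p)); rewrite /rho; lra.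
have [e e0 eP] := (nbhs_colP _ _).1 (filterI decay far).
apply: (near_right0 e0) => r /andP[r0 re].
have lr0 : 0 < lam * r ^+ 2 by rewrite mulr_gt0// exprn_gt0.
apply: (@near_pinfty _ _ (2 / (rho * (lam * r ^+ 2)))) => tau tauT.
apply: interior_local_max => //.
  exact: (smooth2_cont (smooth2_sum p sf tau)).
move=> y yr bdy; have [|[dec _] fary] := eP y.
  by move=> j; exact: le_lt_trans (yr j) re.
have small := spike_lt rho0 (ltW fary) lr0 tauT.
have : lam * r ^+ 2 <= lam * sqnorm (y - x).
  by rewrite ler_pM2l// sqnorm_boundary.
have := gauss_gt0 (fun=> tau) (fun j => p j 0) x; rewrite -/(spike p tau x).
lra.
Qed.

(** The spike adds 1 at its centre and almost nothing at distance [r], where the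
continuous function has hardly changed. *)
Lemma max_close_centre :
  \forall r \near 0^'+, \forall tau \near +oo, max_close p r tau.
Proof.
have nf : \forall y \near p, f y < f p + 2^-1.
  by apply: (continuous_near_lt (smooth2_cont sf)); lra.
have /nbhs_colP[e e0 eP] := nf.
apply: (near_right0 e0) => r /andP[r0 re].
have r20 : 0 < r ^+ 2 by rewrite exprn_gt0.
apply: (@near_pinfty _ _ (2 / (r ^+ 2 * 2^-1))) => tau tauT.
apply: interior_local_max => //.
  exact: (smooth2_cont (smooth2_sum p sf tau)).
move=> y yr bdy; have fy : f y < f p + 2^-1.
  by apply: eP => j; exact: le_lt_trans (yr j) re.
have half0 : 0 < 2^-1 :> R by rewrite invr_gt0.
have small := spike_lt r20 (sqnorm_boundary bdy) half0 tauT.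
have -> : spike p tau p = 1.
  rewrite spikeE subrr /sqnorm big1 => [|j _]; last by rewrite mxE expr0n.
  by rewrite mulr0 oppr0 mul0r expR0.
lra.
Qed.

End SpikeModes.

Lemma near_separated (R : realType) d (O : finType) (P : O -> 'cV[R]_d) :
  injective P ->
  \forall r \near 0^'+, forall Z : O -> 'cV[R]_d,
    (forall o j, `|Z o j 0 - P o j 0| < r) -> injective Z.
Proof.
move=> Pinj.
pose apart (oo : O * O) (r : R) := oo.1 != oo.2 ->
  exists j, 2 * r <= `|P oo.1 j 0 - P oo.2 j 0|.
have sep oo : \forall r \near 0^'+, apart oo r.
  rewrite /apart.
  have [->|o12] := eqVneq oo.1 oo.2; first by apply: nearW => r /eqP.
  have [j /eqP Pj] : exists j, P oo.1 j 0 <> P oo.2 j 0.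
    apply/existsNP => all_eq; move/eqP: o12; apply; apply: Pinj.
    by apply/colP => j.
  have D0 : 0 < `|P oo.1 j 0 - P oo.2 j 0| / 2.
    by rewrite divr_gt0// normr_gt0 subr_eq0.
  apply: (near_right0 D0) => r /andP[_ rD] _; exists j.
  by move: rD; rewrite ltr_pdivlMr// mulrC => /ltW.
have all_apart : \forall r \near 0^'+, forall oo, apart oo r.
  exact: filter_forall.
apply: filterS all_apart => r rP Z ZP o o' Zoo; apply/eqP/negPn/negP => oo'.
have [j] := rP (o, o') oo'; rewrite /= leNgt => /negP; apply.
have h1 := ZP o j; have h2 := ZP o' j; rewrite -Zoo in h2; rewrite distrC in h1.
have := ler_distD (Z o j 0) (P o j 0) (P o' j 0); lra.
Qed.

(** Place the new component at a noncritical point [p], outside the cube that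
contains all critical points, and let its width tend to 0. The old modes
survive and [p] yields a new one, while no degenerate critical point with
nonpositive Hessian appears near [p] or, by compactness, elsewhere. *)
Lemma attains_S (R : realType) d k N : (0 < d)%N -> (0 < k)%N ->
  attains R d k N -> attains R d k.+1 N.+1.
Proof.
move=> d0 k0 [I [c [a [mu [g [h [[Ik c0 a0 sg nd] [X [Xinj XP]]]]]]]]].
have /card_gt0P[i0 _] : (0 < #|I|)%N by rewrite Ik.
pose j0 : 'I_d := Ordinal d0.
have [M M0 cM] := exists_confined mu a0.
pose p : 'cV[R]_d := const_mx M.
have cp : ~ critical g p.
  move=> cp; have := critical_confined i0 j0 c0 a0 (ltW M0) cM sg cp.
  by rewrite mxE gtr0_norm// ltxx.
pose M' := M * (d%:R + 1).
have M'M : M <= M' by rewrite ler_pMr// lerDr.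
pose c' (i : I + unit) := if i is inl i then c i else 1.
pose a' tau (i : I + unit) := if i is inl i then a i else fun=> tau.
pose mu' (i : I + unit) := if i is inl i then mu i else fun j => p j 0.
have mixE tau : mixture c' (a' tau) mu' =
    fun y => mixture c a mu y + spike p tau y.
  apply/funext => y; rewrite /mixture big_sumType /=; congr (_ + _).
  by rewrite (bigD1 tt)//= big1 ?addr0 ?mul1r// => -[].
have c'0 i : 0 < c' i by case: i => [i|[]] /=.
have cM' tau : 0 < tau -> confined M' (a' tau) mu'.
  move=> tau0 [i|[]] j /=; first exact: confined_widen a0 (ltW M0) M'M cM i j.
  rewrite -mulr_sumr ltr_pM2l//.
  rewrite (eq_bigr (fun=> M ^+ 2)) => [|l _]; last by rewrite mxE.
  rewrite sumr_const card_ord -mulr_natl /M' exprMn mulrC.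
  rewrite ltr_pM2l ?exprn_gt0//.
  have : 0 <= d%:R :> R by []; move: (d%:R : R) => D; nra.
pose P (o : option 'I_N) := if o is Some n then X n else p.
have XPp n : X n != p.
  by apply/eqP => Xp; apply: cp; rewrite -Xp; case: (XP n).
have Pinj : injective P.
  move=> [n|] [n'|] //= e; first by rewrite (Xinj _ _ e).
    by have := XPp n; rewrite e eqxx.
  by have := XPp n'; rewrite -e eqxx.
have close : \forall r \near 0^'+, forall o, \forall tau \near +oo,
    max_close p (f := mixture c a mu) (P o) r tau.
  apply: (@filter_forall _ _ (fun o r => \forall tau \near +oo,
    max_close p (f := mixture c a mu) (P o) r tau)) => -[n|].
    by have [cX hX] := XP n; exact: max_close_mode sg _ cX hX (XPp n).
  exact: max_close_centre sg.
have [r [r_close r_sep]] :=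
  @filter_ex _ (0^'+) _ _ (filterI close (near_separated Pinj)).
have all_close : \forall tau \near +oo, forall o,
  max_close p (f := mixture c a mu) (P o) r tau by exact: filter_forall.
have all_good : \forall tau \near +oo,
    box 0 M' `<=` nondegenerate_at (g := g) (h := h) p tau.
  have /compact_near_coveringP := @box_compact R d 0 M'; apply => x _.
  have [T near_good] : exists T : R, \forall y \near x, forall tau, T < tau ->
      nondegenerate_at (g := g) (h := h) p tau y.
    by have [->|xp] := eqVneq x p; [exact: nondegenerate_near sg cp|exact (nondegenerate_far sg nd xp)].
  exists ([set y | forall tau, T < tau -> nondegenerate_at (g := g) (h := h) p tau y],
          [set tau | T < tau]).
    by split => //=; exists T; split => //; exact: num_real.
  by move=> [y tau] [/= yP Ttau]; exact: yP.
have [tau [[tau0 tau_good] tau_close]] :=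
  @filter_ex _ +oo _ _ (filterI (filterI (nbhs_pinfty_gt (num_real 0)) all_good) all_close).
have a'0 i j : 0 < a' tau i j by case: i => [i|[]] /=.
have ss := smooth2_sum p sg tau; rewrite -mixE in ss.
have nd' : nondegenerate (sum_grad (g := g) p tau) (sum_hess (h := h) p tau).
  move=> x cx; apply: tau_good => // j; rewrite mxE subr0.
  apply/ltW/(critical_confined (inr tt) j c'0 a'0 _ (cM' _ tau0) ss cx).
  exact: le_trans (ltW M0) M'M.
exists (I + unit)%type, c', (a' tau), mu'.
exists (sum_grad (g := g) p tau), (sum_hess (h := h) p tau).
split; first by split => //; rewrite card_sum card_unit Ik addn1.
have /choice[Z ZP] : forall o : option 'I_N, exists z : 'cV[R]_d,
    local_max (mixture c' (a' tau) mu') z /\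
    forall j, `|z j 0 - P o j 0| < r.
  by move=> o; have [z zmax zr] := tau_close o; exists z; rewrite mixE.
have Zinj : injective Z by apply: r_sep => o j; case: (ZP o).
have card_eq : #|{: option 'I_N}| = N.+1 by rewrite card_option card_ord.
exists (fun n => Z (enum_val (cast_ord (esym card_eq) n))); split.
  by move=> n n' /Zinj/enum_val_inj/cast_ord_inj.
move=> n; have [zmax _] := ZP (enum_val (cast_ord (esym card_eq) n)).
have [cz hz] := local_max_critical ss zmax.
by split => //; exact: nd'.
Qed.

(** * Two components with d + 1 modes *)

(** The last point of [a, b] where [phi] is nonnegative is a zero, and [phi]
cannot increase through it. *)
Lemma downcrossing (R : realType) (phi dphi : R -> R) (a b : R) : a < b ->
  (forall t : R, is_derive t 1 phi (dphi t)) -> 0 < phi a -> phi b < 0 ->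
  exists2 z, a < z < b & phi z = 0 /\ dphi z <= 0.
Proof.
move=> ab dphiP pa pb.
have cphi : continuous phi.
  by move=> t; apply/differentiable_continuous/derivable1_diffP; case: (dphiP t).
pose A : set R := `[a, b]%classic `&` phi @^-1` [set y | 0 <= y].
have cA : compact A.
  apply: (@subclosed_compact _ _ `[a, b]%classic); last by move=> x [].
    apply: closedI; first exact: itv_closed.
    by apply: preimage_closed => [x _|]; [exact: cphi|exact: closed_ge].
  exact: segment_compact.
have aA : A a by split; rewrite /= ?in_itv /= ?lexx ltW.
have [||z /set_mem[zab /= z0] zmax] := @compact_EVT_max R R id A _ cA.
- by exists a.
- by apply: continuous_subspaceT => x; exact: cvg_id.
move: zab; rewrite /= in_itv /= => /andP[az zb].
have zb' : z < b.
  by rewrite lt_neqAle zb andbT; apply: contraTneq z0 => ->; rewrite -ltNge.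
have last y : z < y -> y <= b -> phi y < 0.
  move=> zy yb; rewrite ltNge; apply/negP => y0.
  have : y <= z.
    by apply: zmax; apply/mem_set; split=> //=; rewrite in_itv /= yb (le_trans az)// ltW.
  by rewrite leNgt zy.
have phiz : phi z = 0.
  apply/eqP; rewrite eq_le z0 andbT leNgt; apply/negP => z_gt.
  have [e /= e0 eP] := continuous_near_gt cphi z_gt.
  pose y := Num.min b (z + e / 2).
  have zy : z < y by rewrite lt_min zb' ltrDl divr_gt0.
  have yb : y <= b by rewrite ge_min lexx.
  have yze : y <= z + e / 2 by rewrite ge_min lexx orbT.
  have := eP y; rewrite /ball_ /= ltr0_norm ?subr_lt0// opprB => /(_ _)/ltW.
  by rewrite leNgt last// => /(_ _)/negP; apply; lra.
exists z; last first.
  split => //; rewrite leNgt; apply/negP => dz0.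
  have [e e0 pos] := derive_gt0_near (dphiP z) phiz dz0.
  pose w := Num.min (b - z) (e / 2).
  have w0 : 0 < w by rewrite lt_min subr_gt0 zb' divr_gt0.
  have wb : w <= b - z by rewrite ge_min lexx.
  have we : w <= e / 2 by rewrite ge_min lexx orbT.
  have := pos w; rewrite w0 /= => /(_ _)/ltW; rewrite leNgt last ?ltrDl//; last by lra.
  by move=> /(_ _)/negP; apply; lra.
rewrite zb' andbT lt_neqAle az andbT; apply: contraTneq pa => ->.
by rewrite phiz ltxx.
Qed.

Lemma exists_avoiding (R : realFieldType) (s : seq R) (a b : R) : a < b ->
  exists2 x, a < x < b & x \notin s.
Proof.
elim: s a b => [|z s IH] a b ab; first by exists ((a + b) / 2) => //; lra.
have [/andP[az zb]|zab] := boolP (a < z < b).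
  have [x /andP[ax xz] xs] := IH a z az.
  exists x; first by rewrite ax (lt_trans xz).
  by rewrite in_cons negb_or xs andbT lt_eqF.
have [x xab xs] := IH a b ab; exists x => //.
by rewrite in_cons negb_or xs andbT; apply: contraNneq zab => <-.
Qed.

Lemma finite_poly_roots (R : idomainType) (q : {poly R}) : q != 0 ->
  finite_set [set t | root q t].
Proof.
move=> q0; apply: contrapT => /(infinite_set_fset (size q))[B Bq].
rewrite leqNgt => /negP; apply; apply: max_poly_roots => //.
  by apply/allP => t tB; exact: Bq.
exact: fset_uniq.
Qed.

Section TwoComponents.
Context {R : realType} {d : nat}.
Variables (L kap : R) (r : 'I_d -> R).
Hypothesis L0 : 0 < L.
Hypothesis r0 : forall j, 0 < r j.

(** The function exp (- L |x| ^ 2) + exp (kap - L sum_j (x_j - 1) ^ 2 / r_j): an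
isotropic component at the origin and, at the point with all coordinates 1, a
component whose widths in the coordinate directions are free parameters. *)
Definition two_c (b : bool) : R := if b then 1 else expR kap.
Definition two_a (b : bool) (j : 'I_d) : R := if b then 2 * L else 2 * L / r j.
Definition two_mu (b : bool) (j : 'I_d) : R := if b then 0 else 1.

Definition first_part (x : 'cV[R]_d) : R := gauss (two_a true) (two_mu true) x.
Definition second_part (x : 'cV[R]_d) : R :=
  expR kap * gauss (two_a false) (two_mu false) x.

Definition ratio x := second_part x / first_part x.

Lemma first_gt0 x : 0 < first_part x. Proof. exact: gauss_gt0. Qed.

Lemma second_gt0 x : 0 < second_part x.
Proof. by rewrite mulr_gt0 ?expR_gt0 ?gauss_gt0. Qed.

Lemma ratio_gt0 x : 0 < ratio x.
Proof. by rewrite divr_gt0 ?first_gt0 ?second_gt0. Qed.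

Lemma second_ratio x : second_part x = ratio x * first_part x.
Proof. by rewrite /ratio divfK// gt_eqF ?first_gt0. Qed.

Notation grad := (mixture_grad two_c two_a two_mu).
Notation hess := (mixture_hess two_c two_a two_mu).

Lemma two_gradE x j : grad x j =
  - (2 * L) * first_part x / r j * (x j 0 * (r j + ratio x) - ratio x).
Proof.
rewrite /mixture_grad big_bool /= /gauss_grad -/(first_part x) mul1r.
rewrite mulrCA -/(second_part x) second_ratio.
by rewrite /two_a /two_mu; field; rewrite gt_eqF.
Qed.

Definition ridge (t : R) (j : 'I_d) : R := t / (r j + t).

(** For a fixed ratio of the two parts the gradient equation is linear in each
coordinate, and its solution traces the ridge line as the ratio varies. *)
Lemma critical_ridge x : critical grad x <-> forall j, x j 0 = ridge (ratio x) j.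
Proof.
have tj j : 0 < r j + ratio x by rewrite addr_gt0 ?ratio_gt0.
split=> cx j.
  have k0 : - (2 * L) * first_part x / r j != 0.
    by rewrite mulf_neq0 ?invr_eq0 ?mulf_neq0 ?oppr_eq0 ?gt_eqF ?first_gt0 ?mulr_gt0.
  move: (cx j); rewrite two_gradE => /eqP; rewrite mulf_eq0 (negbTE k0) /=.
  by rewrite subr_eq0 => /eqP E; rewrite /ridge -{1}E mulfK// gt_eqF.
by rewrite two_gradE cx /ridge divfK ?gt_eqF// subrr mulr0.
Qed.

Definition slope (t : R) : R :=
  \sum_j 2 * L * r j * t * (1 + t) / (r j + t) ^+ 3.

Definition stretch t j : R := (r j + t) / r j.

(** [slope t] is the quantity that decides the sign of the Hessian at a critical
point; it is also [1] plus the derivative of [height] in the variable [ln t]. *)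
Lemma slope_ridge t : 0 < t ->
  slope t = 2 * L * (1 + t) / t * \sum_j ridge t j ^+ 2 / stretch t j.
Proof.
move=> t0; rewrite mulr_sumr; apply: eq_bigr => j _.
by rewrite /ridge /stretch; field; rewrite !gt_eqF ?addr_gt0.
Qed.

(** On the ridge the two rank-one terms of the Hessian are proportional. *)
Lemma hess_ridge x u : critical grad x ->
  qform (hess x) u = 2 * L * first_part x *
    (2 * L * (1 + ratio x) / ratio x * (\sum_j ridge (ratio x) j * u j 0) ^+ 2 -
     \sum_j stretch (ratio x) j * u j 0 ^+ 2).
Proof.
move=> /critical_ridge cx; set t := ratio x in cx *.
have t0 : 0 < t by exact: ratio_gt0.
have -> : qform (hess x) u = qform (gauss_hess (two_a true) (two_mu true) x) u +
    expR kap * qform (gauss_hess (two_a false) (two_mu false) x) u.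
  rewrite /qform mulr_sumr -big_split; apply: eq_bigr => i _ /=.
  rewrite mulr_sumr -big_split; apply: eq_bigr => j _ /=.
  by rewrite /mixture_hess big_bool /=; ring.
rewrite !qform_gauss -/(first_part x) mulrCA -/(second_part x) second_ratio -/t.
set X := \sum_j ridge t j * u j 0.
have -> : \sum_j two_a true j * (x j 0 - two_mu true j) * u j 0 = 2 * L * X.
  by rewrite mulr_sumr; apply: eq_bigr => j _; rewrite /= subr0 cx; ring.
have -> : \sum_j two_a false j * (x j 0 - two_mu false j) * u j 0 =
    - (2 * L / t) * X.
  rewrite mulr_sumr; apply: eq_bigr => j _; rewrite /= cx /ridge.
  by field; rewrite !gt_eqF ?addr_gt0.
have -> : \sum_j stretch t j * u j 0 ^+ 2 =
    (\sum_j two_a true j * u j 0 ^+ 2 + t * \sum_j two_a false j * u j 0 ^+ 2) /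
    (2 * L).
  rewrite mulr_sumr -big_split mulr_suml; apply: eq_bigr => j _ /=.
  by rewrite /stretch; field; rewrite !gt_eqF.
move: (\sum_j _) (\sum_j _) => S1 S2.
by field; rewrite !gt_eqF.
Qed.

Lemma stretch_gt0 t j : 0 < t -> 0 < stretch t j.
Proof. by move=> t0; rewrite divr_gt0 ?addr_gt0. Qed.

Lemma two_hess_lt0 x : critical grad x -> slope (ratio x) < 1 -> hess_lt0 hess x.
Proof.
move=> cx; have t0 := ratio_gt0 x; set t := ratio x in t0 *.
have F0 : 0 < 2 * L * first_part x by rewrite !mulr_gt0 ?first_gt0.
move=> st; exists (2 * L * first_part x * (1 - slope t)) => [|u].
  by rewrite mulr_gt0// subr_gt0.
rewrite hess_ridge// -/t; move: (2 * L * first_part x) F0 => F F0.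
have -> : - (F * (1 - slope t)) * sqnorm u = F * ((slope t - 1) * sqnorm u) by ring.
rewrite ler_pM2l//.
have cs := cauchy_schwarz_weighted (ridge t) (fun j => u j 0)
  (fun j => stretch_gt0 j t0).
set X := (\sum_j _) ^+ 2 in cs *; set U := \sum_j stretch t j * _ in cs *.
have k0 : 0 <= 2 * L * (1 + t) / t.
  by rewrite ltW// divr_gt0// !mulr_gt0 ?addr_gt0.
have le1 : 2 * L * (1 + t) / t * X <= slope t * U.
  by rewrite slope_ridge// -[leRHS]mulrA ler_wpM2l.
have le2 : sqnorm u <= U.
  apply: ler_sum => j _; rewrite ler_peMl ?sqr_ge0// /stretch.
  by rewrite ler_pdivlMr// mul1r lerDl ltW.
apply: (@le_trans _ _ ((slope t - 1) * U)); first by lra.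
by rewrite ler_wnM2l// subr_le0 ltW.
Qed.

(** Otherwise the Hessian would be positive in the direction where the
Cauchy-Schwarz inequality is an equality. *)
Lemma slope_le1 x : critical grad x -> hess_le0 hess x -> slope (ratio x) <= 1.
Proof.
move=> cx hx; have t0 := ratio_gt0 x; set t := ratio x in t0 *.
pose s := \sum_j ridge t j ^+ 2 / stretch t j.
pose k := 2 * L * (1 + t) / t.
have k0 : 0 < k by rewrite divr_gt0// !mulr_gt0 ?addr_gt0.
have slopeE : slope t = k * s by exact: slope_ridge.
pose u : 'cV[R]_d := \col_j (ridge t j / stretch t j).
have := hx u; rewrite hess_ridge// -/t -/k.
have -> : \sum_j ridge t j * u j 0 = s.
  by apply: eq_bigr => j _; rewrite mxE expr2 mulrA.
have -> : \sum_j stretch t j * u j 0 ^+ 2 = s.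
  apply: eq_bigr => j _; rewrite mxE; field.
  by rewrite gt_eqF ?stretch_gt0.
rewrite pmulr_rle0 ?mulr_gt0 ?first_gt0// expr2 mulrA -slopeE => le0.
rewrite leNgt; apply/negP => sl.
have s0 : 0 < s by rewrite -(pmulr_rgt0 _ k0) -slopeE (lt_trans ltr01).
have : 0 < (slope t - 1) * s by rewrite mulr_gt0// subr_gt0.
by rewrite mulrBl mul1r ltNge le0.
Qed.

(** Taking logarithms, the ratio at the point of parameter [t] of the ridge line
is [t] itself exactly when [height t = 0]. Each term of [stairs] rises from about
0 to 1 as [t] passes [r_j]. *)
Definition stairs (t : R) : R := \sum_j (t ^+ 2 - r j) / (r j + t) ^+ 2.
Definition height (t : R) : R := kap + L * stairs t - ln t.

Lemma ratio_ridge (x : 'cV[R]_d) t : 0 < t -> (forall j, x j 0 = ridge t j) ->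
  ratio x = expR (kap + L * stairs t).
Proof.
move=> t0 xE; rewrite /ratio /second_part /first_part /gauss -expRD -expRN -expRD.
congr expR; rewrite -addrA; congr (kap + _).
rewrite -mulNr opprK addrC -mulrDl -sumrB mulr_suml /stairs mulr_sumr.
apply: eq_bigr => j _; rewrite /= xE /ridge.
by field; rewrite !gt_eqF ?addr_gt0.
Qed.

Lemma critical_height x : critical grad x -> height (ratio x) = 0.
Proof.
move=> /critical_ridge cx; have t0 := ratio_gt0 x.
by rewrite /height {2}(ratio_ridge t0 cx) expRK subrr.
Qed.

Lemma height_critical t (x : 'cV[R]_d) : 0 < t -> height t = 0 ->
  (forall j, x j 0 = ridge t j) -> critical grad x /\ ratio x = t.
Proof.
move=> t0 ht xE.
have rx : ratio x = t.
  rewrite (ratio_ridge t0 xE) -[RHS]lnK ?posrE//; congr expR.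
  by apply/eqP; rewrite -subr_eq0; apply/eqP.
by split => //; apply/critical_ridge; rewrite rx.
Qed.

Lemma two_nondegenerate :
  (forall t, 0 < t -> slope t = 1 -> height t <> 0) -> nondegenerate grad hess.
Proof.
move=> reg x cx hx; apply: two_hess_lt0 => //.
rewrite lt_neqAle slope_le1// andbT; apply/eqP => s1.
by apply: (reg _ (ratio_gt0 x) s1); exact: critical_height.
Qed.

Lemma is_derive_height (s : R) :
  is_derive s 1 (fun s => height (expR s)) (slope (expR s) - 1).
Proof.
pose w j (s : R) : R := (r j + expR s)^-1.
have pos j s' : 0 < r j + expR s' by rewrite addr_gt0 ?expR_gt0.
have dw j : is_derive s 1 (w j) (- expR s * w j s ^+ 2).
  have D : is_derive s 1 (fun s => r j + expR s) (expR s).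
    by apply: is_derive_eq; rewrite add0r mul1r.
  have DV := @is_deriveV R (fun s => r j + expR s) s (expR s) 1
    (lt0r_neq0 (pos j s)) D.
  suff -> : - expR s * w j s ^+ 2 = - (r j + expR s) ^- 2 * expR s by [].
  by rewrite /w; field; rewrite gt_eqF.
have dj j : is_derive s 1
    (fun s => 1 - 2 * r j * w j s + (r j ^+ 2 - r j) * w j s ^+ 2)
    (2 * r j * expR s * (1 + expR s) / (r j + expR s) ^+ 3).
  have D := dw j; apply: is_derive_eq; rewrite /GRing.scale /=.
  by rewrite /w; field; rewrite gt_eqF.
have := is_derive_sumf dj => DS.
have -> : (fun s => height (expR s)) = fun s => kap + L * (\sum_j (1 -
    2 * r j * w j s + (r j ^+ 2 - r j) * w j s ^+ 2)) - s.
  apply/funext => s'; rewrite /height expRK; congr (kap + L * _ - _).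
  by apply: eq_bigr => j _; rewrite /w; field; rewrite gt_eqF.
apply: is_derive_eq; rewrite add0r mul1r /GRing.scale /= /slope mulr_sumr.
by congr (_ - 1); apply: eq_bigr => j _; ring.
Qed.

(** Once denominators are cleared, [slope t = 1] is a polynomial equation that
fails at [t = 0]. *)
Lemma finite_slope1 : finite_set [set t | 0 < t /\ slope t = 1].
Proof.
pose D j : {poly R} := ((r j)%:P + 'X) ^+ 3.
pose q := \prod_j D j -
  \sum_j (2 * L * r j)%:P * 'X * (1 + 'X) * \prod_(i | i != j) D i.
have hD j t : (D j).[t] = (r j + t) ^+ 3 by rewrite /D !hornerE.
have q0 : q != 0.
  apply/eqP => /(congr1 (horner^~ 0)) /eqP.
  rewrite horner0 /q hornerD hornerN horner_prod horner_sum.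
  rewrite [X in _ - X]big1 => [|j _]; last by rewrite !hornerE; ring.
  rewrite subr0 gt_eqF//; apply: prodr_gt0 => j _.
  by rewrite hD addr0 exprn_gt0.
apply: sub_finite_set (finite_poly_roots q0) => t [t0 st] /=.
rewrite /root /q hornerD hornerN horner_prod horner_sum subr_eq0; apply/eqP.
transitivity (slope t * \prod_j (D j).[t]); first by rewrite st mul1r.
rewrite mulr_suml; apply: eq_bigr => j _.
rewrite (bigD1 j)//= hD !hornerM horner_prod !hornerE /=.
by field; rewrite gt_eqF ?addr_gt0.
Qed.

End TwoComponents.

Lemma stair_low (R : realType) (r t q : R) : 0 < t -> 1 <= r -> q <= 1 ->
  t <= r * q -> r^-1 <= q -> `|(t ^+ 2 - r) / (r + t) ^+ 2| <= 2 * q.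
Proof.
move=> t0 r1 q1 tq rq; have r0 : 0 < r by rewrite (lt_le_trans ltr01).
have q0 : 0 < q by rewrite (lt_le_trans _ rq)// invr_gt0.
have rrq : 1 <= r * q by rewrite mulrC -ler_pdivrMr// mul1r.
have D0 : 0 < (r + t) ^+ 2 by rewrite exprn_gt0// addr_gt0.
rewrite ler_norml ler_pdivrMr// ler_pdivlMr//.
have rt : r ^+ 2 <= (r + t) ^+ 2.
  by rewrite ler_sqr ?nnegrE ?addr_ge0 ?ltW// ltrDl.
have q2 : 2 * q * r ^+ 2 <= 2 * q * (r + t) ^+ 2 by rewrite ler_pM2l// mulr_gt0.
have t2 : t ^+ 2 <= r ^+ 2 * q.
  apply: (@le_trans _ _ ((r * q) ^+ 2)).
    by rewrite ler_sqr// nnegrE ltW// mulr_gt0.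
  by rewrite exprMn ler_pM2l ?exprn_gt0// expr2 ler_piMl// ltW.
have rr : r <= r ^+ 2 * q by rewrite expr2 -mulrA ler_peMr// ltW.
have t20 : 0 <= t ^+ 2 by exact: sqr_ge0.
by apply/andP; split; lra.
Qed.

Lemma stair_high (R : realType) (r t q : R) : 0 < t -> 1 <= r -> r <= t * q ->
  `|(t ^+ 2 - r) / (r + t) ^+ 2 - 1| <= 2 * q.
Proof.
move=> t0 r1 rq; have r0 : 0 < r by rewrite (lt_le_trans ltr01).
have q0 : 0 < q by rewrite -(pmulr_rgt0 _ t0) (lt_le_trans r0).
have rt0 : 0 < r + t by rewrite addr_gt0.
have D0 : 0 < (r + t) ^+ 2 by rewrite exprn_gt0.
have -> : (t ^+ 2 - r) / (r + t) ^+ 2 - 1 =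
    - ((2 * r * t + r ^+ 2 + r) / (r + t) ^+ 2) by field; rewrite gt_eqF.
have n0 : 0 <= 2 * r * t + r ^+ 2 + r.
  by rewrite !addr_ge0 ?mulr_ge0 ?sqr_ge0 ?ltW.
rewrite normrN ger0_norm; last by apply: divr_ge0 => //; exact: ltW.
rewrite ler_pdivrMr//.
have le1 : 2 * r * t + r ^+ 2 + r <= 2 * r * (r + t).
  have : r <= r ^+ 2 by rewrite expr2 ler_peMl// ltW.
  lra.
have le2 : r * (r + t) <= q * (r + t) * (r + t).
  by rewrite ler_pM2r// (le_trans rq)// mulrC ler_pM2l// lerDr ltW.
by rewrite expr2; lra.
Qed.

(** With [r_j] of size [exp ((j + 1) L)] the staircase [L * stairs] has steps of
height and width about [L], so [height] crosses 0 downwards once on each of the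
[d + 1] treads, between [(i + 1/4) L] and [(i + 3/4) L]. Each crossing is
a mode, and a generic [kap] makes all critical points nondegenerate. *)
Lemma attains_2 (R : realType) d : (0 < d)%N -> attains R d 2 d.+1.
Proof.
(* The errors of the d terms of the staircase, at most 2 exp (- L / 4) each, then
   add up to at most 1/16. *)
move=> d0; pose L : R := 128 * d.+1%:R.
have L0 : 0 < L by rewrite mulr_gt0// ltr0n.
pose r (j : 'I_d) : R := expR (j.+1%:R * L).
have r0 j : 0 < r j by exact: expR_gt0.
have r1 j : 1 <= r j by rewrite -expR0 ler_expR mulr_ge0// ltW.
pose q : R := expR (- (L / 4)).
have q0 : 0 < q by exact: expR_gt0.
have q1 : q <= 1 by rewrite -expR0 ler_expR oppr_le0 divr_ge0// ltW.
have dq : 2 * q * d%:R <= 16^-1.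
  have : (expR (L / 4))^-1 <= (32 * d.+1%:R)^-1.
    rewrite lef_pV2 ?posrE ?expR_gt0 ?mulr_gt0 ?ltr0n//.
    by apply: le_trans (expR_ge1Dx _); rewrite /L; lra.
  rewrite -expRN -/q => qle.
  have D0 : 0 < d.+1%:R :> R by rewrite ltr0n.
  have : q * d.+1%:R <= 32^-1.
    by rewrite -ler_pdivlMr// -invfM.
  rewrite -natr1 mulrDr; lra.
have stairs_close (i : 'I_d.+1) s : (i%:R + 4^-1) * L <= s ->
    s <= (i%:R + 3 / 4) * L -> `|stairs r (expR s) - i%:R| <= 16^-1.
  move=> s_ge s_le.
  have -> : i%:R = \sum_(j < d) (j < i)%N%:R :> R.
    have id : (i <= d)%N by rewrite -ltnS.
    rewrite -natr_sum -(big_mkord xpredT (fun j => nat_of_bool (j < i)%N)).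
    rewrite (big_cat_nat (leq0n i) id)/= (eq_big_nat _ _ (F2 := fun=> 1%N)); last first.
      by move=> j /= ->.
    rewrite sum_nat_const_nat subn0 muln1 big_nat big1 ?addn0// => j.
    by move=> /andP[ij _]; rewrite ltnNge ij.
  rewrite -sumrB; apply: le_trans dq; apply: le_trans (ler_norm_sum _ _ _) _.
  have -> : 2 * q * d%:R = \sum_(j < d) 2 * q.
    by rewrite sumr_const card_ord mulr_natr.
  apply: ler_sum => j _; have t0 := expR_gt0 s.
  case: (ltnP j i) => ji.
    apply: stair_high => //; rewrite -expRD ler_expR.
    have : j.+1%:R * L <= i%:R * L by rewrite ler_pM2r// ler_nat.
    by move: s_ge; rewrite mulrDl; lra.
  rewrite subr0; apply: stair_low => //.
    rewrite -expRD ler_expR.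
    have : i.+1%:R * L <= j.+1%:R * L by rewrite ler_pM2r// ler_nat ltnS.
    by move: s_le; rewrite -natr1 !mulrDl; lra.
  rewrite -expRN ler_expR lerN2.
  have : 1 * L <= j.+1%:R * L by rewrite ler_pM2r// ler1n.
  by move: L0; lra.
have /finite_seqP[flat flatE] := finite_slope1 L r0.
have flatP t : 0 < t -> slope L r t = 1 -> t \in flat.
  by move=> t0 st; have : [set` flat] t by rewrite -flatE.
(* L / 2 would centre the crossings on the treads; the tolerance L / 16 leaves room
   to avoid the finitely many degenerate values. *)
have [kap /andP[kap_gt kap_lt] kap_generic] :=
  @exists_avoiding R [seq ln t - L * stairs r t | t <- flat] (7 / 16 * L) (9 / 16 * L)
    ltac:(lra).
have regular t : 0 < t -> slope L r t = 1 -> height L kap r t <> 0.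
  move=> t0 /(flatP _ t0) tflat ht; move/negP: kap_generic; apply.
  apply/mapP; exists t => //; apply/eqP; rewrite -subr_eq0 -ht /height.
  by apply/eqP; ring.
have crossing (i : 'I_d.+1) : exists s,
    [/\ (i%:R + 4^-1) * L < s, s < (i%:R + 3 / 4) * L,
        height L kap r (expR s) = 0 & slope L r (expR s) < 1].
  have lt_ab : (i%:R + 4^-1) * L < (i%:R + 3 / 4) * L by rewrite ltr_pM2r//; lra.
  have := stairs_close i _ (lexx _) (ltW lt_ab).
  have := stairs_close i _ (ltW lt_ab) (lexx _).
  rewrite !ler_norml => /andP[_ hi] /andP[lo _].
  have [| |s /andP[s_gt s_lt] [hs ds]] :=
    downcrossing lt_ab (is_derive_height L kap r0).
  - rewrite /height expRK.
    have : L * (i%:R - 16^-1) <= L * stairs r (expR ((i%:R + 4^-1) * L)).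
      by rewrite ler_pM2l//; lra.
    by move: kap_gt; lra.
  - rewrite /height expRK.
    have : L * stairs r (expR ((i%:R + 3 / 4) * L)) <= L * (i%:R + 16^-1).
      by rewrite ler_pM2l//; lra.
    by move: kap_lt; lra.
  exists s; split => //; rewrite lt_neqAle; apply/andP; split; last by lra.
  by apply/eqP => s1; exact: regular (expR_gt0 s) s1 hs.
have [s sP] := choice crossing.
pose X (i : 'I_d.+1) : 'cV[R]_d := \col_j ridge r (expR (s i)) j.
exists bool, (two_c kap), (two_a L r), (@two_mu R d).
exists (mixture_grad (two_c kap) (two_a L r) (@two_mu R d)).
exists (mixture_hess (two_c kap) (two_a L r) (@two_mu R d)).
split; first split.
- by rewrite card_bool.
- by case => //=; exact: expR_gt0.
- by case=> j /=; rewrite ?divr_gt0// mulr_gt0.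
- exact: smooth2_mixture.
- exact: two_nondegenerate.
exists X; split=> [i i'|i]; last first.
  have [_ _ hs ds] := sP i.
  have [|cX rX] := height_critical L0 r0 (expR_gt0 (s i)) hs (x := X i).
    by move=> j; rewrite mxE.
  by split => //; apply: two_hess_lt0 => //; rewrite rX.
move=> /colP/(_ (Ordinal d0)); rewrite !mxE /ridge.
move: (r _) (r0 (Ordinal d0)) => rho rho0 E.
have {}E : expR (s i) = expR (s i').
  have neq u : rho + expR u != 0 by rewrite gt_eqF// addr_gt0// expR_gt0.
  move/eqP: E; rewrite eqr_div// => /eqP E.
  apply: (mulIf (lt0r_neq0 rho0)); apply/eqP; rewrite -subr_eq0; apply/eqP.
  by move/eqP: E; rewrite -subr_eq0 => /eqP <-; ring.
move/expR_inj: E => E.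
have [gi li _ _] := sP i; have [gi' li' _ _] := sP i'.
have apart (m n : nat) (u : R) : (m%:R + 4^-1) * L < u -> u < (n%:R + 3 / 4) * L ->
    (m <= n)%N.
  move=> um un; rewrite leqNgt; apply/negP => nm.
  have : n.+1%:R * L <= m%:R * L by rewrite ler_pM2r// ler_nat.
  by move: um un; rewrite -(natr1 n) !mulrDl; lra.
apply/val_inj/eqP; rewrite eqn_leq (apart i i' (s i))// ?E//.
by rewrite (apart i' i (s i'))// -E.
Qed.

(** * Back to normalised Gaussian mixtures *)

Lemma quad_form_diag (R : realType) d (v : 'rV[R]_d) (x : 'cV[R]_d) :
  quad_form (diag_mx v) x = \sum_j v 0 j * x j 0 ^+ 2.
Proof.
rewrite /quad_form mul_mx_diag mxE; apply: eq_bigr => j _; rewrite !mxE.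
by rewrite mulrAC -expr2 mulrC.
Qed.

Lemma posdef_diag (R : realType) d (v : 'rV[R]_d) :
  (forall j, 0 < v 0 j) -> posdef (diag_mx v).
Proof.
move=> v0; split; first exact: tr_diag_mx.
move=> x x0; rewrite quad_form_diag.
have [j xj] : exists j, x j 0 <> 0.
  by apply/existsNP => x_eq0; move/eqP: x0; apply; apply/colP => j; rewrite mxE.
rewrite (bigD1 j)//= ltr_wpDr//.
  by apply: sumr_ge0 => i _; rewrite mulr_ge0 ?sqr_ge0// ltW.
by rewrite mulr_gt0// lt_neqAle sqr_ge0 andbT eq_sym sqrf_eq0; apply/eqP.
Qed.

Lemma invmx_diag (R : realType) d (v : 'rV[R]_d) : (forall j, 0 < v 0 j) ->
  invmx (diag_mx v) = diag_mx (\row_j (v 0 j)^-1).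
Proof.
move=> v0; have vu : diag_mx v \in unitmx.
  by rewrite unitmxE det_diag unitfE; apply/prodf_neq0 => j _; rewrite gt_eqF.
apply: (can_inj (mulKmx vu)); rewrite mulmxV// mulmx_diag -diag_const_mx.
by congr diag_mx; apply/rowP => j; rewrite !mxE divff// gt_eqF.
Qed.

Lemma gaussian_density_diag (R : realType) d (a mu : 'I_d -> R) :
  (forall j, 0 < a j) -> exists2 Z : R, 0 < Z & forall x : 'cV[R]_d,
    gaussian_density (\col_j mu j) (diag_mx (\row_j (a j)^-1)) x = Z * gauss a mu x.
Proof.
move=> a0; set S := diag_mx _.
have v0 j : 0 < (\row_j (a j)^-1 : 'rV[R]_d) 0 j by rewrite mxE invr_gt0.
exists ((2 * pi) `^ (- (d%:R / 2)) * (\det S) `^ (- 2^-1)) => [|x].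
  rewrite mulr_gt0// powR_gt0 ?mulr_gt0 ?pi_gt0//.
  by rewrite det_diag prodr_gt0// => j _.
rewrite /gaussian_density /S invmx_diag// quad_form_diag; congr (_ * expR _).
rewrite mulNr mulNr mulrC; congr (- (_ / _)); apply: eq_bigr => j _.
by rewrite !mxE invrK.
Qed.

Lemma coord_le_euclidean (R : realType) d (x : 'cV[R]_d) j :
  `|x j 0| <= euclidean_norm x.
Proof. by rewrite -sqrtr_sqr ler_wsqrtr// sqr_coord_le. Qed.

Lemma euclidean_lt (R : realType) d (x : 'cV[R]_d) (rho : R) : 0 < rho ->
  (forall j, `|x j 0| < rho / d.+1%:R) -> euclidean_norm x < rho.
Proof.
move=> rho0 xr; rewrite -[rho]gtr0_norm// -sqrtr_sqr ltr_sqrt ?exprn_gt0//.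
have D0 : 0 < d.+1%:R :> R by rewrite ltr0n.
apply: (@le_lt_trans _ _ (d%:R * (rho / d.+1%:R) ^+ 2)).
  have -> : d%:R * (rho / d.+1%:R) ^+ 2 = \sum_(j < d) (rho / d.+1%:R) ^+ 2.
    by rewrite sumr_const card_ord mulr_natl.
  apply: ler_sum => j _; rewrite -[x j 0 ^+ 2]real_normK ?num_real//.
  by rewrite ler_sqr ?nnegrE// ltW// divr_gt0.
rewrite expr_div_n mulrA ltr_pdivrMr ?exprn_gt0// mulrC ltr_pM2l ?exprn_gt0//.
have : 0 <= d%:R :> R by [].
rewrite -natr1; move: (d%:R : R) => D; nra.
Qed.

Lemma ModeP (R : realType) d (f : 'cV[R]_d -> R) (x : 'cV[R]_d) :
  Mode f x <-> local_max f x.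
Proof.
split=> [[rho rho0 fx]|/nbhs_colP[e e0 fx]].
  apply/nbhs_colP; exists (rho / d.+1%:R); first by rewrite divr_gt0// ltr0n.
  by move=> y yx; apply: fx; apply: euclidean_lt => // j; have := yx j; rewrite !mxE.
exists e => // y yx; apply: fx => j; apply: le_lt_trans yx.
by have := coord_le_euclidean (y - x) j; rewrite !mxE.
Qed.

Lemma local_max_scale (R : realType) d (f : 'cV[R]_d -> R) (W : R) x : 0 < W ->
  local_max (fun y => f y / W) x <-> local_max f x.
Proof.
move=> W0; rewrite /local_max.
by split; apply: filterS => y; rewrite ler_pM2r ?invr_gt0.
Qed.

(** Local maxima are confined to a cube, and no point of it is a limit of other
local maxima: being noncritical or having an ascending second derivative is an open condition,
and elsewhere nondegeneracy isolates. *)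
Lemma finite_local_max (R : realType) d (I : finType) (c : I -> R)
    (a mu : I -> 'I_d -> R) g h : (0 < #|I|)%N ->
  (forall i, 0 < c i) -> (forall i j, 0 < a i j) ->
  smooth2 (mixture c a mu) g h -> nondegenerate g h ->
  finite_set (local_max (mixture c a mu)).
Proof.
move=> /card_gt0P[i0 _] c0 a0 sf nd.
have [M M0 cM] := exists_confined mu a0.
apply: (compact_isolated_finite (@box_compact R d 0 M)) => [x|x _].
  move=> /(local_max_critical sf)[cx _] j; rewrite mxE subr0.
  exact/ltW/(critical_confined i0 j c0 a0 (ltW M0) cM sf cx).
have [cx|/existsNP[j /eqP gx]] := pselect (critical g x); last first.
  have gx0 : 0 < `|g x j| by rewrite normr_gt0.
  have := continuous_near_gt (continuous_abs (smooth2_grad_cont sf j)) gx0.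
  apply: filterS => y gy /(local_max_critical sf)[/(_ j) gy0 _].
  by rewrite gy0 normr0 ltxx in gy.
have [hx|/existsNP[u /negP]] := pselect (hess_le0 h x); last first.
  rewrite -ltNge => hu.
  have ch : continuous (fun y => qform (h y) u).
    apply: continuous_sumf => i; apply: continuous_sumf => j.
    exact (continuous_mul (smooth2_hess_cont sf i j) (@continuous_cst _ _ _)).
  have := continuous_near_gt ch hu.
  apply: filterS => y hy /(local_max_critical sf)[_ /(_ u)].
  by rewrite leNgt hy.
have [lam _] := critical_decay sf cx (nd x cx hx).
by apply: filterS => y [_ uniq_y] /(local_max_critical sf)[cy _]; exact: uniq_y.
Qed.

Lemma attains_max_modes (R : realType) d k N : (0 < k)%N -> attains R d k N ->
  (N%:R%:E <= max_modes R d k)%E.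
Proof.
move=> k0 [I [c [a [mu [g [h [[Ik c0 a0 sf nd] [X [Xinj XP]]]]]]]]].
have I0 : (0 < #|I|)%N by rewrite Ik.
have /card_gt0P[i0 _] := I0.
have /choice[Z ZP] : forall i, exists Z : R, 0 < Z /\ forall x : 'cV[R]_d,
    gaussian_density (\col_j mu i j) (diag_mx (\row_j (a i j)^-1)) x =
    Z * gauss (a i) (mu i) x.
  by move=> i; have [Z Z0 ZE] := gaussian_density_diag (mu i) (a0 i); exists Z.
have Z0 i : 0 < Z i by case: (ZP i).
pose W := \sum_i c i / Z i.
have W0 : 0 < W.
  rewrite /W (bigD1 i0)//= ltr_wpDr ?divr_gt0//.
  by apply: sumr_ge0 => i _; rewrite ltW// divr_gt0.
pose f x := mixture c a mu x / W.
have maxE x : Mode f x <-> local_max (mixture c a mu) x.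
  by rewrite ModeP; exact: local_max_scale.
have finM : finite_set (Mode f).
  apply: sub_finite_set (finite_local_max I0 c0 a0 sf nd) => x.
  by move/maxE.
apply: (@le_trans _ _ (#|` fset_set (Mode f)|%fset%:R)%:E); last first.
  apply: ereal_sup_ubound; exists f => //; split => //.
  pose e (n : 'I_k) : I := enum_val (cast_ord (esym Ik) n).
  have e_bij : bijective e.
    apply: bij_comp; first exact: enum_val_bij.
    by exists (cast_ord Ik) => n; rewrite ?cast_ordK ?cast_ordKV.
  exists (fun n => c (e n) / Z (e n) / W), (fun n => \col_j mu (e n) j).
  exists (fun n => diag_mx (\row_j (a (e n) j)^-1)); split.
  - by move=> n; rewrite !divr_gt0.
  - have WE : \sum_n c (e n) / Z (e n) = W.
      by rewrite /W (reindex e (onW_bij _ e_bij)).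
    by rewrite -mulr_suml WE divff// gt_eqF.
  - by move=> n; apply: posdef_diag => j; rewrite mxE invr_gt0.
  move=> x; rewrite /f /mixture (reindex e (onW_bij _ e_bij)) mulr_suml.
  apply: eq_bigr => n _; rewrite (ZP (e n)).2; field.
  by rewrite !gt_eqF.
rewrite lee_fin ler_nat.
have XM n : X n \in fset_set (Mode f).
  rewrite in_fset_set//; apply/mem_set/maxE; have [cX hX] := XP n.
  have [lam lam0] := critical_decay sf cX hX.
  apply: filterS => y [le_y _]; apply: le_trans le_y _.
  by rewrite gerBl mulr_ge0 ?sqnorm_ge0// ltW.
rewrite -[N]card_ord cardE -(size_map X).
apply: uniq_leq_size; first by rewrite map_inj_uniq ?enum_uniq.
by move=> _ /mapP[n _ ->].
Qed.

(** * The lower bound *)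

Lemma attains_power (R : realType) d m : (0 < d)%N ->
  attains R (m * d) (2 ^ m) (d.+1 ^ m).
Proof.
move=> d0; elim: m => [|m IH]; first exact: attains_0.
rewrite mulSn !expnS; apply: attains_mul => //; first by rewrite expn_gt0.
exact: attains_2.
Qed.

Lemma attains_addn (R : realType) d k N n : (0 < d)%N -> (0 < k)%N ->
  attains R d k N -> attains R d (n + k) (n + N).
Proof.
move=> d0 k0 H; elim: n => // n IH.
by rewrite !addSn; apply: attains_S => //; rewrite addn_gt0 k0 orbT.
Qed.

(** A product over [s] blocks of coordinates uses [2 ^ s] components, and a block of
dimension [e] contributes a factor [e + 1]. Block dimensions as equal as possible
give the largest product; the other [k - 2 ^ s] components add one mode each. *)
Lemma attains_blocks (R : realType) d k s : (0 < s)%N -> (s <= d)%N ->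
  (2 ^ s <= k)%N ->
  attains R d k (k - 2 ^ s +
    (d %/ s + 1) ^ (s - d %% s) * (d %/ s + 2) ^ (d %% s)).
Proof.
move=> s0 sd sk.
have q0 : (0 < d %/ s)%N by rewrite divn_gt0.
have rs : (d %% s <= s)%N by rewrite ltnW// ltn_pmod.
have := attains_mul _ _ (attains_power R (s - d %% s) q0)
  (attains_power R (d %% s) (ltn0Sn (d %/ s))).
rewrite !expn_gt0 => /(_ isT isT).
have -> : ((s - d %% s) * (d %/ s) + d %% s * (d %/ s).+1 = d)%N.
  rewrite mulnBl mulnS addnCA subnK ?leq_mul2r ?rs ?orbT//.
  by rewrite addnC mulnC -divn_eq.
rewrite -expnD subnK// => H; rewrite addn1 addn2.
rewrite -[X in attains _ _ X](subnK sk).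
apply: attains_addn => //; first exact: leq_trans s0 sd.
by rewrite expn_gt0.
Qed.

Theorem corollary4p5 (R : realType) (d k : nat) (hd : (1 <= d)%N) (hk : (2 <= k)%N) :
  (((Lpp d k)%:R)%:E <= max_modes R d k)%E.
Proof.
have k0 : (0 < k)%N by exact: leq_trans hk.
have term s : (1 <= s < (minn d (trunc_log 2 k)).+1)%N ->
    (((k - 2 ^ s + (d %/ s + 1) ^ (s - d %% s) * (d %/ s + 2) ^ (d %% s))%:R)%:E
      <= max_modes R d k)%E.
  rewrite ltnS leq_min => /and3P[s0 sd slog].
  apply: attains_max_modes => //; apply: attains_blocks => //.
  by apply: leq_trans (trunc_logP (isT : 1 < 2)%N k0); rewrite leq_exp2l.
rewrite /Lpp big_nat.
apply: (big_ind (fun n => n%:R%:E <= max_modes R d k)%E) => //.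
- apply: le_trans (term 1%N _); first by rewrite lee_fin.
  by rewrite /= ltnS leq_min hd trunc_log_gt0.
- by move=> m n Hm Hn; rewrite /maxn; case: ifP.
Qed.
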